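(* Let $X$ be a spectrally negative Lévy process with Lévy triplet $(\gamma,\sigma,\Pi)$ such that $\Pi$ has a strictly positive density $\pi$ on $(0,\infty)$ with respect to Lebesgue measure, and assume that $\Phi(0)=0$. Let $W=W^{(0)}$ be the $0$-scale function of $X$. If the function $x\mapsto\overline{\Pi}(x)=\int_x^\infty\pi(s)\,ds$ is log convex on $(0,\infty)$, then the function $W'$ is convex on $(0,\infty)$. Furthermore, if $X$ has a Gaussian term (i.e. $\sigma>0$), or equivalently the drift of the descending ladder height process of $X$ is strictly positive, then $W\in C^2(0,\infty)$.
   Context: A spectrally negative Lévy process $X$ is a real-valued Lévy process with no positive jumps which, as usual, is not the negative of a subordinator (paths not monotone decreasing). Its triplet is $(\gamma,\sigma,\Pi)$ with $\gamma\in\mathbb{R}$, $\sigma\ge 0$, and $\Pi$ a measure on $(0,\infty)$ with $\int_0^\infty(1\wedge x^2)\Pi(dx)<\infty$ (the Lévy measure is carried by $(0,\infty)$ although jumps are negative); its Laplace exponent is $$\psi(\theta)=\log \mathbb{E}(e^{\theta X_1})=\gamma\theta+\tfrac12\sigma^2\theta^2-\int_0^\infty\left(1-e^{-\theta x}-\theta x1_{\{0<x<1\}}\right)\Pi(dx),\quad \theta\ge0.$$ $\Phi(0)\ge 0$ denotes the largest real root of $\psi$ on $[0,\infty)$ (so $\Phi(0)>0$ iff $X$ drifts to $-\infty$, iff $\psi'(0+)<0$). The $0$-scale function $W:\mathbb{R}\to[0,\infty)$ is the unique function with $W(x)=0$ for $x<0$ which on $[0,\infty)$ is continuous and non-decreasing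 with $\int_0^\infty e^{-\theta x}W(x)\,dx=1/\psi(\theta)$ for $\theta>\Phi(0)$. The descending ladder height process of $X$ is the (possibly killed) subordinator with Laplace exponent $\phi$ determined by $\psi(\theta)=(\theta-\Phi(0))\phi(\theta)$, $\theta\ge0$; its drift is $\sigma^2/2$. *)

(* Defs.v *)
From HB Require Import structures.
From mathcomp Require Import all_boot all_order all_algebra.
From mathcomp Require Import all_classical all_reals all_analysis.

Set Implicit Arguments.
Unset Strict Implicit.
Unset Printing Implicit Defensive.

Import Order.TTheory GRing.Theory Num.Theory.
Import numFieldNormedType.Exports.

Local Open Scope classical_set_scope.
Local Open Scope ring_scope.

(* Processes are indexed by all of R for convenience; every clause below only
   constrains the times t >= 0. *)

Definition independent_increments (R : realType) d (Omega : measurableType d)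
    (P : probability Omega R) (X : R -> {RV P >-> R}) : Prop :=
  forall (n : nat) (t : nat -> R) (B : nat -> set R),
    0 <= t 0%N ->
    (forall i, (i < n)%N -> t i <= t i.+1) ->
    (forall i, (i < n)%N -> measurable (B i)) ->
    (* The product rule for subfamilies is the case B i = setT. *)
    P (\bigcap_(i in `I_n) [set w | B i (X (t i.+1) w - X (t i) w)])
    = (\prod_(i < n) P [set w | B i (X (t i.+1) w - X (t i) w)%R])%E.

Definition stationary_increments (R : realType) d (Omega : measurableType d)
    (P : probability Omega R) (X : R -> {RV P >-> R}) : Prop :=
  forall (s t : R) (B : set R), 0 <= s -> s <= t -> measurable B ->
    P [set w | B (X t w - X s w)] = P [set w | B (X (t - s) w)].

Definition cadlag (R : realType) (x : R -> R) : Prop :=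
  (forall t, 0 <= t -> x u @[u --> t^'+] --> x t) /\
  (forall t, 0 < t -> cvg (x u @[u --> t^'-])).

Definition levy_process (R : realType) d (Omega : measurableType d)
    (P : probability Omega R) (X : R -> {RV P >-> R}) : Prop :=
  [/\ {ae P, forall w, X 0 w = 0},
      {ae P, forall w, cadlag (fun t => X t w)},
      independent_increments X &
      stationary_increments X].

Definition no_positive_jump (R : realType) (x : R -> R) : Prop :=
  forall t, 0 < t -> x t <= lim (x u @[u --> t^'-]).

Definition decreasing_path (R : realType) (x : R -> R) : Prop :=
  forall s t, 0 <= s -> s <= t -> x t <= x s.

Definition spectrally_negative_levy_process (R : realType) d
    (Omega : measurableType d) (P : probability Omega R)
    (X : R -> {RV P >-> R}) : Prop :=
  [/\ levy_process X,
      {ae P, forall w, no_positive_jump (fun t => X t w)} &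
      ~ {ae P, forall w, decreasing_path (fun t => X t w)}].

(* The Levy measure of -X: it charges (0, +oo) only, although X jumps
   downwards. *)
Definition levy_measure (R : realType) (Pi : {measure set R -> \bar R}) : Prop :=
  Pi `]-oo, 0]%classic = 0%E /\
  (\int[Pi]_(x in `]0%R, +oo[) (Num.min 1 (x ^+ 2))%:E < +oo)%E.

Definition laplace_exponent (R : realType) (gamma sigma : R)
    (Pi : {measure set R -> \bar R}) (theta : R) : R :=
  gamma * theta + 2^-1 * sigma ^+ 2 * theta ^+ 2
  - \int[Pi]_(x in `]0, +oo[)
      (1 - expR (- (theta * x)) - theta * x * \1_`]0, 1[ x).

Definition levy_triplet (R : realType) d (Omega : measurableType d)
    (P : probability Omega R) (X : R -> {RV P >-> R})
    (gamma sigma : R) (Pi : {measure set R -> \bar R}) : Prop :=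
  [/\ 0 <= sigma,
      levy_measure Pi &
      forall theta, 0 <= theta ->
        'E_P[(fun w => expR (theta * X 1 w))%R]%E
        = (expR (laplace_exponent gamma sigma Pi theta))%:E].

Definition positive_density (R : realType) (Pi : {measure set R -> \bar R})
    (dens : R -> R) : Prop :=
  [/\ measurable_fun (`]0, +oo[%classic : set R) dens,
      (forall x, 0 < x -> 0 < dens x) &
      forall A : set R, measurable A -> A `<=` `]0, +oo[ ->
        Pi A = (\int[lebesgue_measure]_(x in A) (dens x)%:E)%E].

Definition tail (R : realType) (dens : R -> R) (x : R) : R :=
  \int[lebesgue_measure]_(s in `]x, +oo[) dens s.

Definition convex_on (R : realType) (D : set R) (f : R -> R) : Prop :=
  @convex_function R R^o D f.

(* Positivity is part of the notion because ln is 0 on nonpositive reals. *)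
Definition log_convex_on (R : realType) (D : set R) (f : R -> R) : Prop :=
  (forall x, D x -> 0 < f x) /\ convex_on D (fun x => ln (f x)).

Definition largest_root (R : realType) (psi : R -> R) (r : R) : Prop :=
  [/\ 0 <= r, psi r = 0 & forall theta, 0 <= theta -> psi theta = 0 -> theta <= r].

Definition scale_function (R : realType) (psi : R -> R) (Phi0 : R)
    (W : R -> R) : Prop :=
  [/\ (forall x, 0 <= W x),
      (forall x, x < 0 -> W x = 0),
      {within `[0, +oo[, continuous W},
      {in `[0, +oo[ &, {homo W : x y / x <= y}} &
      forall theta, Phi0 < theta ->
        (\int[lebesgue_measure]_(x in `[0%R, +oo[)
            (expR (- (theta * x)) * W x)%:E)%E
        = (1 / psi theta)%:E].

Definition subordinator_exponent (R : realType) (kappa delta : R)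
    (Lambda : {measure set R -> \bar R}) (theta : R) : R :=
  kappa + delta * theta
  + \int[Lambda]_(x in `]0, +oo[) (1 - expR (- (theta * x))).

Definition subordinator_characteristics (R : realType) (kappa delta : R)
    (Lambda : {measure set R -> \bar R}) : Prop :=
  [/\ 0 <= kappa, 0 <= delta, Lambda `]-oo, 0]%classic = 0%E &
      (\int[Lambda]_(x in `]0%R, +oo[) (Num.min 1 x)%:E < +oo)%E].

(* Killing rate kappa, drift delta and Levy measure Lambda of the descending
   ladder height process, i.e. of the killed subordinator whose Laplace exponent
   phi satisfies psi(theta) = (theta - Phi(0)) phi(theta). At theta = Phi(0)
   this equation is void, but phi is continuous there. *)
Definition descending_ladder_height (R : realType) (psi : R -> R) (Phi0 : R)
    (kappa delta : R) (Lambda : {measure set R -> \bar R}) : Prop :=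
  subordinator_characteristics kappa delta Lambda /\
  forall theta, 0 <= theta ->
    psi theta = (theta - Phi0) * subordinator_exponent kappa delta Lambda theta.

Definition differentiable_on_pos (R : realType) (f : R -> R) : Prop :=
  forall x, 0 < x -> derivable f x 1.

Definition C2_on_pos (R : realType) (f : R -> R) : Prop :=
  [/\ differentiable_on_pos f,
      differentiable_on_pos (f^`())%classic &
      forall x, 0 < x -> {for x, continuous (f^`(2))%classic}].

(* Main.v *)
(* As [Phi(0) = 0], [psi(t) = t chi(t)] where [chi] is the Laplace exponent of
   the descending ladder height process, whose Levy measure has the density
   [g = tail dens]; formally [delta W' + k * W' = 1] with [delta = sigma^2 / 2]
   and [- k' = g]. This Volterra equation is discretized exactly: at each rate
   [lam], the values of [W] at Gamma(n + 1, lam) distributed times average to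
   the coefficient [u_n] of [z ^ n] in [1 / ((1 - z) chi(lam (1 - z)))], so that
   the increments [w_n] of [u] satisfy a renewal equation
   [c w_n = a_1 w_(n-1) + ... + a_n w_0], in which [a] is, up to an increase of
   [a_1], the Poisson transform of [g]. Log convexity of [g] makes [a] log
   convex, hence [w] is log convex (de Bruijn-Erdos) and thus convex, and
   nonincreasing because [a_1 + a_2 + ... <= c]. By the law of large numbers
   [u] converges to [W] as [lam] tends to infinity: finite difference
   inequalities for [u] pass to [W] and give the regularity and the convexity
   of [W']. If [delta > 0], taking second differences in the discrete Volterra
   equation bounds those of [W'] by [o(h)], which makes the convex function [W']
   continuously differentiable. *)
Require Import Defs.
From HB Require Import structures.
From mathcomp Require Import all_boot all_order all_algebra.
From mathcomp Require Import all_classical all_reals all_analysis.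
From mathcomp Require Import measurable_realfun.
From mathcomp Require Import lra ring zify.

Set Implicit Arguments.
Unset Strict Implicit.
Unset Printing Implicit Defensive.

Import Order.TTheory GRing.Theory Num.Theory.
Import numFieldNormedType.Exports.

Local Open Scope classical_set_scope.
Local Open Scope ring_scope.

(** * Log convex renewal sequences *)

Section convex_sequences.
Variable R : realType.
Implicit Types (v w : nat -> R).

(** Besides its sign, continuity and monotonicity, only the Laplace transform of [W] is given, so no
    derivative of [W] can be used before it is shown to exist. Every estimate on [u] is therefore an
    inequality between finitely many of its values, of a form that survives the scaling of indices
    by [lam] and the limit. Concavity of [W] alone would allow kinks; they are excluded by a bound
    on the second differences of [u] that is quadratic in the step, drawn from the convexity and
    monotonicity of [w]. The discretization is exact because the generating function of a Poisson
    transform at [z] is the Laplace transform at [lam (1 - z)]. In [chi(lam (1 - z))] the drift term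
    [delta lam (1 - z)] adds [delta lam] both to [c] and to [a_1]. Log convexity tolerates this,
    since [a_1] occurs only on the larger side of [a_2 ^ 2 <= a_1 a_3]. *)

Definition convex_seq v := forall n, 0 <= v n - v n.+1 *+ 2 + v n.+2.

Lemma convex_seq_incr v m n : convex_seq v -> (m <= n)%N ->
  v m.+1 - v m <= v n.+1 - v n.
Proof.
move=> cv /subnKC <-; elim: (n - m)%N => [|k IH]; first by rewrite addn0.
by rewrite addnS (le_trans IH)//; have := cv (m + k)%N; rewrite mulr2n; lra.
Qed.

Lemma convex_seq_left v n p : convex_seq v ->
  v (n + p)%N - v n <= p%:R * (v (n + p).+1 - v (n + p)%N).
Proof.
move=> cv; elim: p => [|p IH]; first by rewrite addn0 mul0r subrr.
have H := convex_seq_incr cv (leqnSn (n + p)).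
have : p%:R * (v (n + p).+1 - v (n + p)%N) <= p%:R * (v (n + p).+2 - v (n + p).+1).
  exact: ler_wpM2l.
by rewrite addnS -natr1; lra.
Qed.

Lemma convex_seq_right v n q : convex_seq v ->
  q%:R * (v n.+1 - v n) <= v (n + q)%N - v n.
Proof.
move=> cv; elim: q => [|q IH]; first by rewrite addn0 mul0r subrr.
have H := convex_seq_incr cv (leq_addr q n).
by rewrite addnS -natr1; lra.
Qed.

Lemma convex_seq_three v n p q : convex_seq v ->
  (p + q)%:R * v (n + p)%N <= q%:R * v n + p%:R * v (n + p + q)%N.
Proof.
move=> cv; rewrite natrD.
have H1 : q%:R * (v (n + p)%N - v n) <=
    q%:R * (p%:R * (v (n + p).+1 - v (n + p)%N)).
  by apply: ler_wpM2l => //; exact: convex_seq_left.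
have H2 : p%:R * (q%:R * (v (n + p).+1 - v (n + p)%N)) <=
    p%:R * (v (n + p + q)%N - v (n + p)%N).
  by apply: ler_wpM2l => //; exact: convex_seq_right.
nra.
Qed.

(** An increment that is positive once bounds all later ones from below, and [v] would grow at least
    linearly. *)
Lemma convex_seq_bounded v M : convex_seq v -> (forall n, v n <= M) ->
  forall n, v n.+1 <= v n.
Proof.
move=> cv vM n; rewrite leNgt; apply/negP => vn.
have d0 : 0 < v n.+1 - v n by rewrite subr_gt0.
pose q := Num.truncn ((M - v n) / (v n.+1 - v n)).
have := convex_seq_right n q.+1 cv.
have := vM (n + q.+1)%N.
have : (M - v n) / (v n.+1 - v n) < q.+1%:R.
  by rewrite truncnS_gt.
by rewrite ltr_pdivrMr//; lra.
Qed.

Lemma seq_noninc v : (forall n, v n.+1 <= v n) ->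
  forall m n, (m <= n)%N -> v n <= v m.
Proof.
move=> vS m n /subnKC <-; elim: (n - m)%N => [|k IH]; first by rewrite addn0.
by rewrite addnS (le_trans _ IH).
Qed.

(** [2 v_(n+1) <= 2 sqrt (v_n v_(n+2)) <= v_n + v_(n+2)], written with squares. *)
Lemma log_convex_convex_seq v : (forall n, 0 < v n) ->
  (forall n, v n.+1 ^+ 2 <= v n * v n.+2) -> convex_seq v.
Proof.
move=> v0 lv n; have := lv n; have := v0 n; have := v0 n.+1; have := v0 n.+2.
move: (v n) (v n.+1) (v n.+2) => x y z z0 y0 x0 yxz.
rewrite mulr2n.
have : (y *+ 2) ^+ 2 <= (x + z) ^+ 2.
  by rewrite mulr2n; have := sqr_ge0 (x - z); rewrite !expr2 in yxz *; nra.
rewrite ler_pXn2r// ?nnegrE; [by rewrite mulr2n; lra|by rewrite mulr2n; lra|lra].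
Qed.

(** The ratios [v j.+1 / v j] are nondecreasing. Log convexity is assumed below [n] only, which is
    what the strong induction of [renewal_log_convex] supplies. *)
Lemma log_convex_seq_ratio v n : (forall n, 0 < v n) ->
  (forall j, (j < n)%N -> v j.+1 ^+ 2 <= v j * v j.+2) ->
  forall j, (j <= n)%N -> v j.+1 * v n <= v n.+1 * v j.
Proof.
move=> v0; elim: n => [|n IH] lv j jn.
  by move: jn; rewrite leqn0 => /eqP ->.
move: jn; rewrite leq_eqVlt => /orP[/eqP ->//|]; rewrite ltnS => jn.
have H1 := IH (fun i ij => lv i (ltnW ij)) j jn.
have H2 := lv n (ltnSn n).
rewrite -(ler_pM2r (v0 n)).
have := ler_wpM2r (ltW (v0 n.+1)) H1.
have := ler_wpM2r (ltW (v0 j)) H2.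
rewrite expr2; lra.
Qed.

End convex_sequences.

Section renewal_sequence.
(* [a n] is the coefficient [a_(n+1)] of the introduction. *)
Variables (R : realType) (c : R) (a w : nat -> R).
Hypothesis c0 : 0 < c.
Hypothesis a0 : forall n, 0 < a n.
Hypothesis a_log_convex : forall n, a n.+1 ^+ 2 <= a n * a n.+2.
Hypothesis w0E : c * w 0%N = 1.
Hypothesis wSE : forall n, c * w n.+1 = \sum_(i < n.+1) a i * w (n - i)%N.

Lemma renewal_gt0 n : 0 < w n.
Proof.
elim/ltn_ind: n => -[_|n IH]; first by rewrite -(pmulr_rgt0 _ c0) w0E.
rewrite -(pmulr_rgt0 _ c0) wSE big_ord_recl /= ltr_wpDr//.
  by apply: sumr_ge0 => i _; rewrite mulr_ge0 ?ltW// IH// ltnS leq_subr.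
by rewrite mulr_gt0// IH// subn0.
Qed.

(* De Bruijn and Erdos. With [e j = w n * w j.+1 - w n.+1 * w j], which is
   nonpositive below [n] by induction and vanishes at [n], the renewal
   equations at [n.+1] and [n] express [a n * c * e n.+1] as a sum of the
   products [(a n * a i.+1 - a n.+1 * a i) * e (n.-1 - i)] of two nonpositive
   factors. *)
Lemma renewal_log_convex n : w n.+1 ^+ 2 <= w n * w n.+2.
Proof.
elim/ltn_ind: n => n IH.
have ratio := log_convex_seq_ratio renewal_gt0 IH.
pose e j := w n * w j.+1 - w n.+1 * w j.
have e_le0 j : (j <= n)%N -> e j <= 0 by move=> /ratio; rewrite /e; lra.
suff : 0 <= a n * (c * e n.+1).
  by rewrite pmulr_rge0// pmulr_rge0// /e expr2; lra.
have E1 : c * e n.+1 = \sum_(i < n) a i.+1 * e (n.-1 - i)%N + a n.+1 * w n * w 0%N.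
  have H2 : c * w n.+2 = a 0%N * w n.+1 +
      \sum_(i < n) a i.+1 * w (n - i)%N + a n.+1 * w 0%N.
    rewrite wSE big_ord_recl big_ord_recr /= /bump !add1n subnn subn0 addrA.
    by congr (_ + _ + _); apply: eq_bigr => i _; rewrite add1n subSS.
  have H1 : c * w n.+1 = a 0%N * w n + \sum_(i < n) a i.+1 * w (n - i.+1)%N.
    by rewrite wSE big_ord_recl /= subn0.
  have -> : \sum_(i < n) a i.+1 * e (n.-1 - i)%N =
      w n * (\sum_(i < n) a i.+1 * w (n - i)%N)
      - w n.+1 * (\sum_(i < n) a i.+1 * w (n - i.+1)%N).
    rewrite !mulr_sumr -sumrB; apply: eq_bigr => i _; rewrite /e.
    have -> : (n.-1 - i).+1 = (n - i)%N by have := ltn_ord i; lia.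
    have -> : (n.-1 - i)%N = (n - i.+1)%N by lia.
    by ring.
  have -> : c * e n.+1 = w n * (c * w n.+2) - w n.+1 * (c * w n.+1).
    by rewrite /e; ring.
  by rewrite H2 H1; ring.
(* At [n = 0] the equation for [w n] is [w0E], which has no sum to be combined with that of
   [n.+1]. *)
case: (posnP n) => [n0|n_gt0].
  rewrite E1 {1}n0 !mulr_ge0 ?addr_ge0//; first exact: ltW.
    by rewrite n0 big_ord0.
  by rewrite !mulr_ge0// ltW// renewal_gt0.
have E0 : 0 = \sum_(i < n) a i * e (n.-1 - i)%N + a n * w n * w 0%N.
  have H2 : c * w n.+1 = \sum_(i < n) a i * w (n - i)%N + a n * w 0%N.
    by rewrite wSE big_ord_recr /= subnn.
  have H1 : c * w n = \sum_(i < n) a i * w (n.-1 - i)%N.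
    by have := wSE n.-1; rewrite prednK.
  have -> : \sum_(i < n) a i * e (n.-1 - i)%N =
      w n * (\sum_(i < n) a i * w (n - i)%N)
      - w n.+1 * (\sum_(i < n) a i * w (n.-1 - i)%N).
    rewrite !mulr_sumr -sumrB; apply: eq_bigr => i _; rewrite /e.
    have -> : (n.-1 - i).+1 = (n - i)%N by have := ltn_ord i; lia.
    by ring.
  transitivity (w n * (c * w n.+1) - w n.+1 * (c * w n)); first by ring.
  by rewrite H2 H1; ring.
have -> : a n * (c * e n.+1) = a n * (\sum_(i < n) a i.+1 * e (n.-1 - i)%N)
    - a n.+1 * (\sum_(i < n) a i * e (n.-1 - i)%N).
  rewrite E1 mulrDr; congr (_ + _).
  transitivity (a n.+1 * (a n * w n * w 0%N)); first by ring.
  by rewrite -mulrN; congr (_ * _); move: E0; lra.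
rewrite !mulr_sumr -sumrB; apply: sumr_ge0 => i _.
have ain := log_convex_seq_ratio a0 (fun j _ => a_log_convex j) (ltnW (ltn_ord i)).
have := e_le0 (n.-1 - i)%N (leq_trans (leq_subr _ _) (leq_pred n)).
rewrite !mulrA -mulrBl => ei; rewrite mulr_le0//; lra.
Qed.

Lemma renewal_convex : convex_seq w.
Proof. exact: log_convex_convex_seq renewal_gt0 renewal_log_convex. Qed.

Hypothesis a_sum : forall n, \sum_(i < n) a i <= c.

(** The weights [a i / c] have sum at most 1, so each term is at most the maximum of the earlier
    ones. *)
Lemma renewal_le0 n : w n <= w 0%N.
Proof.
elim/ltn_ind: n => -[//|n IH]; rewrite -(ler_pM2l c0) wSE.
rewrite (@le_trans _ _ (\sum_(i < n.+1) a i * w 0%N))//.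
  apply: ler_sum => i _; rewrite ler_wpM2l ?(ltW (a0 _))//.
  by apply: IH; rewrite ltnS leq_subr.
by rewrite -mulr_suml ler_wpM2r// ltW// renewal_gt0.
Qed.

Lemma renewal_nonincS n : w n.+1 <= w n.
Proof. exact: convex_seq_bounded renewal_convex renewal_le0 n. Qed.

Lemma renewal_noninc m n : (m <= n)%N -> w n <= w m.
Proof. exact/seq_noninc/renewal_nonincS. Qed.

Let u n := \sum_(i < n.+1) w i.

Let uS n : u n.+1 = u n + w n.+1. Proof. by rewrite /u big_ord_recr. Qed.

Let u_gt0 n : 0 < u n.
Proof.
by elim: n => [|n IH]; rewrite ?uS ?addr_gt0 ?renewal_gt0// /u big_ord1 renewal_gt0.
Qed.

Let u_nondec m n : (m <= n)%N -> u m <= u n.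
Proof.
move=> /subnKC <-; elim: (n - m)%N => [|k IH]; first by rewrite addn0.
by rewrite addnS uS (le_trans IH)// lerDl ltW// renewal_gt0.
Qed.

Let uDE n m : u (n + m)%N - u n = \sum_(i < m) w (n + i.+1)%N.
Proof.
elim: m => [|m IH]; first by rewrite addn0 subrr big_ord0.
by rewrite addnS uS big_ord_recr /= -IH addnS; ring.
Qed.

Lemma renewal_sum_linear n : c * u n <= n.+1%:R.
Proof.
have -> : n.+1%:R = c * (n.+1%:R * w 0%N) by rewrite mulrCA w0E mulr1.
rewrite ler_pM2l// /u.
rewrite (@le_trans _ _ (\sum_(i < n.+1) w 0%N))//.
  by apply: ler_sum => i _; exact: renewal_le0.
by rewrite sumr_const card_ord mulr_natl.
Qed.

(** With [N = n + j], the second difference is a sum of [m] differences of [w] at distance [m], each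
    at most [w N - w (N + m)]. Convexity compares this drop with the one over the [j] steps before
    [N], so it is at most [(m / j) w n]; and [n.+1 * w n <= u n] because [w] is nonincreasing. The
    square of [m] is what makes [W] derivable in the limit. *)
Lemma renewal_sum_second_diff n j m :
  (j * n.+1)%:R * (u (n + j + m)%N *+ 2 - u (n + j + m + m)%N - u (n + j)%N)
  <= m%:R ^+ 2 * u (n + j)%N.
Proof.
pose N := (n + j)%N; rewrite -/N.
have H1 : u (N + m)%N *+ 2 - u (N + m + m)%N - u N <= m%:R * (w N - w (N + m)%N).
  have -> : u (N + m)%N *+ 2 - u (N + m + m)%N - u N =
    (u (N + m)%N - u N) - (u (N + m + m)%N - u (N + m)%N) by rewrite mulr2n; ring.
  rewrite !uDE -sumrB (@le_trans _ _ (\sum_(i < m) (w N - w (N + m)%N)))//.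
    apply: ler_sum => i _.
    elim: i.+1 => [|k IH]; first by rewrite !addn0.
    rewrite (le_trans _ IH)// !addnS.
    have := @convex_seq_incr _ w (N + k)%N (N + m + k)%N renewal_convex.
    by move=> /(_ ltac:(lia)); lra.
  by rewrite sumr_const card_ord mulr_natl.
have H2 : j%:R * (w N - w (N + m)%N) <= m%:R * w n.
  have := convex_seq_three n j m renewal_convex; rewrite -/N natrD.
  have := mulr_ge0 (ler0n R m) (ltW (renewal_gt0 N)); lra.
have H3 : n.+1%:R * w n <= u N.
  rewrite (le_trans _ (u_nondec (leq_addr j n)))//.
  rewrite mulr_natl -[n.+1 in leLHS]card_ord -sumr_const; apply: ler_sum => i _.
  by apply: renewal_noninc; rewrite -ltnS.
rewrite natrM (le_trans (ler_wpM2l _ H1)) ?mulr_ge0//.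
have H2' : n.+1%:R * (j%:R * (w N - w (N + m)%N)) <= m%:R * u N.
  rewrite (le_trans (ler_wpM2l (ler0n R _) H2))// mulrCA.
  exact: ler_wpM2l.
have := ler_wpM2l (ler0n R m) H2'.
rewrite expr2; lra.
Qed.

(** Sums of [w] over windows of fixed length [m] inherit the convexity of [w]. In the limit,
    [W (x + h) - W x] is convex in [x]. *)
Lemma renewal_sum_convex_incr n m p q :
  (p + q)%:R * (u (n + p + m)%N - u (n + p)%N) <=
  q%:R * (u (n + m)%N - u n) + p%:R * (u (n + p + q + m)%N - u (n + p + q)%N).
Proof.
rewrite !uDE; apply: (convex_seq_three (v := fun n => \sum_(i < m) w (n + i.+1)%N)).
move=> k; rewrite mulr2n -big_split/= -sumrB -big_split/=; apply: sumr_ge0 => i _.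
by have := renewal_convex (k + i.+1)%N; rewrite mulr2n !addSn.
Qed.

(** The kernel of the discrete Volterra equation [kw], which follows from the renewal equation by
    summation by parts. In the application the drift is present in [k 0 = c] only, as subtracting
    [a 0] removes it. *)
Let k n := c - \sum_(i < n) a i.

Let kS n : k n.+1 = k n - a n. Proof. by rewrite /k big_ord_recr /=; ring. Qed.

Let k_ge0 n : 0 <= k n. Proof. by rewrite subr_ge0. Qed.

Let k_noninc m n : (m <= n)%N -> k n <= k m.
Proof. by apply: seq_noninc => i; rewrite kS; have := a0 i; lra. Qed.

Let a_noninc m n : (m <= n)%N -> a n <= a m.
Proof.
apply: seq_noninc => i.
apply: (@convex_seq_bounded _ a c); first exact: log_convex_convex_seq.
move=> j; apply: le_trans (a_sum j.+1); rewrite big_ord_recr /= lerDr.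
by apply: sumr_ge0 => l _; exact: ltW.
Qed.

Let kw n : \sum_(i < n.+1) k i * w (n - i)%N = 1.
Proof.
elim: n => [|n IH]; first by rewrite big_ord1 /= /k big_ord0 subr0.
rewrite big_ord_recl /= subn0 {1}/k big_ord0 subr0 wSE -[RHS]IH -big_split /=.
by apply: eq_bigr => i _; rewrite kS subSS; ring.
Qed.

(** As [k] is nonincreasing, the smaller [k n] may replace every [k i] in [kw]. *)
Let ku n : k n * u n <= 1.
Proof.
rewrite -[leRHS](kw n) /u mulr_sumr [leLHS](reindex_inj rev_ord_inj) /=.
apply: ler_sum => i _; rewrite subSS ler_wpM2r ?(ltW (renewal_gt0 _))//.
by apply: k_noninc; rewrite -ltnS.
Qed.

Let kB n m : k n - k (n + m)%N <= m%:R * a n.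
Proof.
elim: m => [|m IH]; first by rewrite addn0 mul0r subrr.
by rewrite addnS kS -natr1; have := a_noninc (leq_addr m n); lra.
Qed.

(** The [l] terms of [a] from index [j] on are at least [a (j + l)], and their sum is at most
    [k j]. *)
Let ka j l : l%:R * a (j + l)%N <= k j.
Proof.
suff : l%:R * a (j + l)%N <= k j - k (j + l)%N by have := k_ge0 (j + l); lra.
elim: l => [|l IH]; first by rewrite addn0 mul0r subrr.
have := ler_wpM2l (ler0n R l) (a_noninc (leqnSn (j + l))).
have := a_noninc (leqnSn (j + l)).
by rewrite addnS kS -natr1; lra.
Qed.

(* The second difference of the constant sequence [k * w] vanishes. *)
Let second_diff n m :
  c * (w (n + m + m)%N - w (n + m)%N *+ 2 + w n) <=
  k n * ((\sum_(i < m) w i) *+ 2 - \sum_(i < m + m) w i)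
  + m%:R * w 0%N * (k n - k (n + m + m)%N).
Proof.
have sumE N (f : nat -> R) : \sum_(i < N) f (N - i.+1)%N = \sum_(i < N) f i.
  by rewrite [RHS](reindex_inj rev_ord_inj).
(* The convolution at [n + m + m], cut into the indices up to [n] and two blocks of length [m]. *)
have S2 : 1 = \sum_(j < n.+1) k j * w (n - j + m + m)%N
    + \sum_(i < m) k (n.+1 + i)%N * w (m - i.+1 + m)%N
    + \sum_(i < m) k (n.+1 + m + i)%N * w (m - i.+1)%N.
  rewrite -[LHS](kw (n + m + m)) -!addSn !big_split_ord /=.
  congr (_ + _ + _); apply: eq_bigr => i _; congr (_ * w _);
    by have := ltn_ord i; lia.
have S1 : 1 = \sum_(j < n.+1) k j * w (n - j + m)%N
    + \sum_(i < m) k (n.+1 + i)%N * w (m - i.+1)%N.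
  rewrite -[LHS](kw (n + m)) -!addSn !big_split_ord /=.
  congr (_ + _); apply: eq_bigr => i _; congr (_ * w _);
    by have := ltn_ord i; lia.
have S0 := kw n.
pose D j := w (j + m + m)%N - w (j + m)%N *+ 2 + w j.
have D_ge0 j : 0 <= D j.
  have := convex_seq_three j m m renewal_convex.
  rewrite /D natrD mulr2n => H; case: (posnP m) H => [->|m0] H.
    by rewrite !addn0; lra.
  rewrite -(pmulr_rge0 _ (_ : 0 < m%:R)) ?ltr0n//; lra.
(* [k 0 = c], and the other terms can be added since [w] is convex: this isolates [c * D n]. *)
have Dn : c * D n <= \sum_(j < n.+1) k j * D (n - j)%N.
  rewrite big_ord_recl /= subn0 {1}/k big_ord0 subr0 lerDl.
  by apply: sumr_ge0 => i _; rewrite mulr_ge0.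
rewrite -/(D n) (le_trans Dn)//.
(* The combination [S2 - 2 S1 + S0] of the three equations is zero, so the sum of second differences
   equals what is left by the blocks of indices past [n]. *)
have -> : \sum_(j < n.+1) k j * D (n - j)%N =
    \sum_(i < m) (k (n.+1 + i)%N * (w (m - i.+1)%N - w (m - i.+1 + m)%N)
       + (k (n.+1 + i)%N - k (n.+1 + m + i)%N) * w (m - i.+1)%N).
  have -> : \sum_(j < n.+1) k j * D (n - j)%N =
    \sum_(j < n.+1) k j * w (n - j + m + m)%N
    - (\sum_(j < n.+1) k j * w (n - j + m)%N) *+ 2
    + \sum_(j < n.+1) k j * w (n - j)%N.
    rewrite -sumrMnl -sumrB -big_split /=; apply: eq_bigr => i _.
    by rewrite /D !mulr2n; ring.
  have -> : \sum_(i < m) (k (n.+1 + i)%N * (w (m - i.+1)%N - w (m - i.+1 + m)%N)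
       + (k (n.+1 + i)%N - k (n.+1 + m + i)%N) * w (m - i.+1)%N) =
    (\sum_(i < m) k (n.+1 + i)%N * w (m - i.+1)%N) *+ 2
    - \sum_(i < m) k (n.+1 + i)%N * w (m - i.+1 + m)%N
    - \sum_(i < m) k (n.+1 + m + i)%N * w (m - i.+1)%N.
    rewrite -sumrMnl -!sumrB /=; apply: eq_bigr => i _.
    by rewrite !mulr2n; ring.
  by move: S0 S1 S2; rewrite !mulr2n; lra.
rewrite big_split /=; apply: lerD.
  rewrite (@le_trans _ _ (\sum_(i < m) k n * (w (m - i.+1)%N - w (m - i.+1 + m)%N)))//.
    apply: ler_sum => i _; rewrite ler_wpM2r// ?k_noninc//; last lia.
    by rewrite subr_ge0 renewal_noninc//; lia.
  rewrite -mulr_sumr ler_wpM2l// sumrB.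
  rewrite (sumE m w) (sumE m (fun i => w (i + m)%N)) big_split_ord /=.
  have -> : \sum_(i < m) w (m + i)%N = \sum_(i < m) w (i + m)%N.
    by apply: eq_bigr => i _; rewrite addnC.
  by rewrite mulr2n; lra.
rewrite (@le_trans _ _ (\sum_(i < m) (k n - k (n + m + m)%N) * w 0%N))//.
  apply: ler_sum => i _; apply: ler_pM; rewrite ?subr_ge0.
  - by rewrite k_noninc//; lia.
  - exact/ltW/renewal_gt0.
  - by rewrite lerB// k_noninc//; have := ltn_ord i; lia.
  - exact: renewal_le0.
by rewrite sumr_const card_ord -mulrA mulr_natl [_ * w 0%N]mulrC.
Qed.

(** This is [second_diff] summed over the [q] indices after [n]. There [k] is at most [1 / u n], its
    decrease over [2 (m + 1)] indices is at most [2 (m + 1) a n], and [l a n <= k j <= 1 / u j],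
    whence the factor [l]. The windows have length [m.+1] because [u m] has [m.+1] terms. *)
Lemma renewal_sum_third_diff j l m q (n := (j + l)%N) :
  l%:R * c * ((u (n + q + m.+1 + m.+1)%N - u (n + m.+1 + m.+1)%N)
              - (u (n + q + m.+1)%N - u (n + m.+1)%N) *+ 2
              + (u (n + q)%N - u n)) <=
  q%:R * (l%:R * (u m *+ 2 - u (m + m.+1)%N) / u n
          + (m.+1%:R ^+ 2 *+ 2) * w 0%N / u j).
Proof.
have kle i : k i <= (u i)^-1 by rewrite -[leRHS]mul1r ler_pdivlMr.
have U0 : 0 <= u m *+ 2 - u (m + m.+1)%N.
  have -> : u m *+ 2 - u (m + m.+1)%N = u m - (u (m + m.+1)%N - u m).
    by rewrite mulr2n; ring.
  rewrite uDE /u -sumrB; apply: sumr_ge0 => i _.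
  by rewrite subr_ge0 renewal_noninc//; lia.
have step i : (n <= i)%N ->
    c * (w (i + m.+1 + m.+1)%N - w (i + m.+1)%N *+ 2 + w i) <=
    (u m *+ 2 - u (m + m.+1)%N) / u n + m.+1%:R ^+ 2 *+ 2 * w 0%N * a n.
  move=> ni; rewrite (le_trans (second_diff i m.+1))// lerD//.
    rewrite -/(u m) (_ : \sum_(i0 < m.+1 + m.+1) w i0 = u (m + m.+1)%N)//.
    by rewrite mulrC ler_wpM2l// (le_trans (k_noninc ni)).
  have H : k i - k (i + m.+1 + m.+1)%N <= (m.+1 + m.+1)%:R * a n.
    rewrite -addnA (le_trans (kB _ _))// ler_wpM2l//; exact: a_noninc.
  have P0 : 0 <= m.+1%:R * w 0%N by rewrite mulr_ge0// ltW// renewal_gt0.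
  rewrite (le_trans (ler_wpM2l P0 H))// natrD le_eqVlt; apply/orP; left.
  by apply/eqP; ring.
have -> : (u (n + q + m.+1 + m.+1)%N - u (n + m.+1 + m.+1)%N)
              - (u (n + q + m.+1)%N - u (n + m.+1)%N) *+ 2
              + (u (n + q)%N - u n) =
   \sum_(i < q) (w (n + i.+1 + m.+1 + m.+1)%N - w (n + i.+1 + m.+1)%N *+ 2 + w (n + i.+1)%N).
  have E1 : (n + q + m.+1 + m.+1)%N = (n + m.+1 + m.+1 + q)%N by lia.
  have E2 : (n + q + m.+1)%N = (n + m.+1 + q)%N by lia.
  rewrite E1 E2 !uDE -sumrMnl -sumrB -big_split /=; apply: eq_bigr => i _.
  by congr (w _ - w _ *+ 2 + _); lia.
have kaj : l%:R * a n <= (u j)^-1 by rewrite (le_trans (ka j l)).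
have -> B : q%:R * B = \sum_(i < q) B by rewrite sumr_const card_ord mulr_natl.
rewrite mulr_sumr; apply: ler_sum => i _; rewrite -[leLHS]mulrA.
rewrite (le_trans (ler_wpM2l (ler0n R l) (step (n + i.+1)%N (leq_addr _ _))))//.
rewrite mulrDr mulrA lerD2l -[leRHS]mulrA.
have -> : l%:R * (m.+1%:R ^+ 2 *+ 2 * w 0%N * a n) =
   m.+1%:R ^+ 2 *+ 2 * (w 0%N * (l%:R * a n)) by ring.
rewrite ler_wpM2l ?mulrn_wge0 ?sqr_ge0//.
by rewrite ler_wpM2l// ltW// renewal_gt0.
Qed.

End renewal_sequence.

(** * Convex functions *)

Section convex_real_functions.
Variable R : realType.
Implicit Types (f g : R -> R) (x y z h : R).

(** Convexity cleared of denominators, a form that passes to limits and suits linear arithmetic. *)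
Definition three_point_convex f := forall x y z, 0 < x -> x < y -> y < z ->
  (z - x) * f y <= (z - y) * f x + (y - x) * f z.

Lemma convex_on_three_point f : convex_on `]0, +oo[ f -> three_point_convex f.
Proof.
move=> cf x y z x0 xy yz.
have zx : 0 < z - x by lra.
have t0 : 0 <= (z - y) / (z - x) by apply: divr_ge0; lra.
have t1 : (z - y) / (z - x) <= 1 by rewrite ler_pdivrMr// mul1r; lra.
have := cf (Itv01 t0 t1) x z.
rewrite !inE/= !in_itv/= !andbT => /(_ x0 ltac:(lra)).
have E : (z - y) / (z - x) * x + (1 - (z - y) / (z - x)) * z = y.
  by field; lra.
rewrite [X in f X](_ : _ = y)// convRE /= /unstable.onem -(ler_pM2l zx) => /le_trans; apply.
by rewrite le_eqVlt; apply/orP; left; apply/eqP; field; lra.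
Qed.

Lemma three_point_convex_on f : three_point_convex f -> convex_on `]0, +oo[ f.
Proof.
move=> cf t x y; rewrite !inE/= !in_itv/= !andbT => x0 y0.
have [->|xy] := eqVneq x y; first by rewrite !convmm.
have [->|t0] := eqVneq t 0%:i01; first by rewrite !conv0.
have [->|t1] := eqVneq t 1%:i01; first by rewrite !conv1.
rewrite [X in f X](_ : _ = t%:num * x + (1 - t%:num) * y)//.
rewrite convRE /= /unstable.onem.
have {}t0 : 0 < t%:num by rewrite lt_neqAle eq_sym t0 ge0.
have {}t1 : t%:num < 1 by rewrite lt_neqAle t1 le1.
move: (t%:num) t0 t1 => {}t t0 t1.
case/orP : (lt_total xy) => {}xy.
  have d : 0 < y - x by lra.
  have P1 : 0 < (1 - t) * (y - x) by apply: mulr_gt0; lra.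
  have P2 : 0 < t * (y - x) by apply: mulr_gt0; lra.
  rewrite -(ler_pM2l d).
  have := @cf x (t * x + (1 - t) * y) y x0 ltac:(lra) ltac:(lra); lra.
have d : 0 < x - y by lra.
have P1 : 0 < (1 - t) * (x - y) by apply: mulr_gt0; lra.
have P2 : 0 < t * (x - y) by apply: mulr_gt0; lra.
rewrite -(ler_pM2l d).
have := @cf y (t * x + (1 - t) * y) x y0 ltac:(lra) ltac:(lra); lra.
Qed.

(** For convex [f] the second difference divided by [h] is nonnegative and nondecreasing in [h]. One
    [h] for each [e] thus forces the limit 0, and one [h] is all that an argument by contradiction
    along a sequence of steps can provide. *)
Definition flat_second_diff f x := forall e, 0 < e ->
  exists h, [/\ 0 < h, h < x & f (x + h) - f x *+ 2 + f (x - h) <= e * h].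

Definition subgradient f := forall x y, 0 < x -> 0 < y ->
  f x + f^`()%classic x * (y - x) <= f y.

(* The difference quotients increase with the increment, and by the second
   difference estimate the quotients for [h] and [- h] have a common limit. *)
Lemma convex_derivable f x : three_point_convex f -> 0 < x ->
  flat_second_diff f x ->
  derivable f x 1 /\ (forall y, 0 < y -> f x + f^`()%classic x * (y - x) <= f y).
Proof.
move=> cf x0 flat.
pose q h := h^-1 * (f (h + x) - f x).
have qle h k : h != 0 -> k != 0 -> - x < h -> h < k -> q h <= q k.
  move=> h0 k0 xh hk; rewrite /q.
  case/orP: (lt_total h0) => h_0; case/orP: (lt_total k0) => k_0.
  - have := @cf (h + x) (k + x) x ltac:(lra) ltac:(lra) ltac:(lra) => H.
    rewrite -subr_ge0.
    have -> : k^-1 * (f (k + x) - f x) - h^-1 * (f (h + x) - f x) =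
      (h * k)^-1 * (h * (f (k + x) - f x) - k * (f (h + x) - f x)).
      by field; rewrite ?h0 ?k0.
    rewrite mulr_ge0// ?invr_ge0; nra.
  - have := @cf (h + x) x (k + x) ltac:(lra) ltac:(lra) ltac:(lra) => H.
    rewrite -subr_ge0.
    have -> : k^-1 * (f (k + x) - f x) - h^-1 * (f (h + x) - f x) =
      (- h * k)^-1 * (k * (f (h + x) - f x) - h * (f (k + x) - f x)).
      by field; rewrite ?h0 ?k0.
    rewrite mulr_ge0// ?invr_ge0; nra.
  - lra.
  - have := @cf x (h + x) (k + x) ltac:(lra) ltac:(lra) ltac:(lra) => H.
    rewrite -subr_ge0.
    have -> : k^-1 * (f (k + x) - f x) - h^-1 * (f (h + x) - f x) =
      (h * k)^-1 * (h * (f (k + x) - f x) - k * (f (h + x) - f x)).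
      by field; rewrite ?h0 ?k0.
    rewrite mulr_ge0// ?invr_ge0; nra.
pose A := [set q h | h in [set h | - x < h /\ h < 0]].
pose L := sup A.
have A0 : A !=set0 by exists (q (- x / 2)); exists (- x / 2) => //=; lra.
have Aub k : 0 < k -> ubound A (q k).
  move=> k0 _ [h /= [xh h0] <-]; apply: qle => //; lra.
have Lub h : - x < h -> h < 0 -> q h <= L.
  move=> xh h0; apply: ub_le_sup; last by exists h.
  by exists (q 1); exact: Aub.
have Llb k : 0 < k -> L <= q k.
  by move=> k0; apply: ge_sup => //; exact: Aub.
have cvgL : (fun h => h^-1 *: (f (h + x) - f x)) @ 0^' --> L.
  apply/cvgrPdist_le => e e0.
  have [h [h0 hx hD]] := flat _ e0.
  have hd : q h - q (- h) <= e.
    rewrite /q [h + x]addrC [- h + x]addrC.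
    have -> : h^-1 * (f (x + h) - f x) - (- h)^-1 * (f (x - h) - f x) =
       h^-1 * (f (x + h) - f x *+ 2 + f (x - h)) by rewrite mulr2n; field; lra.
    by rewrite mulrC ler_pdivrMr.
  have L1 := Lub (- h) ltac:(lra) ltac:(lra).
  have L2 := Llb h h0.
  near=> k.
  have k0 : k != 0 by near: k; exact: nbhs_dnbhs_neq.
  have kh : `|k| < h by near: k; exact: dnbhs0_lt.
  move: kh; rewrite ltr_norml => /andP[hk kh].
  have q1 : q (- h) <= q k by apply: qle => //; lra.
  have q2 : q k <= q h by apply: qle => //; lra.
  by rewrite ler_norml -/(q k) /GRing.scale/= -/(q k); apply/andP; split; lra.
have Df : derivable f x 1.
  rewrite /derivable; apply/cvg_ex; exists L => /=.
  by under eq_fun do rewrite [_ *: 1]mulr1.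
have fE : f^`()%classic x = L by apply: cvg_lim.
split=> // y y0; rewrite fE.
have [->|yx] := eqVneq y x; first by rewrite subrr mulr0 addr0.
have qE : q (y - x) = (y - x)^-1 * (f y - f x) by rewrite /q subrK.
case/orP: (lt_total yx) => {}yx.
  have := Lub (y - x) ltac:(lra) ltac:(lra); rewrite qE => H.
  have : (y - x) * L <= (y - x) * ((y - x)^-1 * (f y - f x)).
    by rewrite ler_nM2l// subr_lt0.
  by rewrite mulrA divff ?mul1r; lra.
have := Llb (y - x) ltac:(lra); rewrite qE => H.
have : (y - x) * L <= (y - x) * ((y - x)^-1 * (f y - f x)).
  by rewrite ler_pM2l// subr_gt0.
by rewrite mulrA divff ?mul1r; lra.
Unshelve. all: by end_near. Qed.

(** The subgradient inequalities from [x + h / 2] to [x + h], from [x] to [x + h / 2] and from [x]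
    to [x - h] add up to a bound of [(h / 2) (f' (x + h / 2) - f' x)] by the second difference, and
    symmetrically on the left. Monotonicity of [f'] does the rest. *)
Lemma convex_continuous_derive f x : subgradient f -> 0 < x ->
  flat_second_diff f x -> {for x, continuous f^`()%classic}.
Proof.
move=> sf x0 flat; set g := f^`()%classic.
have gm y z : 0 < y -> y <= z -> g y <= g z.
  move=> y0; rewrite le_eqVlt => /orP[/eqP->//|yz].
  have z0 : 0 < z by lra.
  by have := sf y z y0 z0; have := sf z y z0 y0; rewrite -/g; nra.
apply/cvgrPdist_le => e e0.
have e2 : 0 < e / 2 by lra.
have [h [h0 hx hD]] := flat _ e2.
rewrite mulr2n in hD.
have R1 : g (x + h / 2) <= g x + e.
  have H1 := sf (x + h / 2) (x + h) ltac:(lra) ltac:(lra).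
  have H2 := sf x (x + h / 2) ltac:(lra) ltac:(lra).
  have H3 := sf x (x - h) ltac:(lra) ltac:(lra).
  rewrite -/g in H1 H2 H3.
  rewrite -(ler_pM2l (_ : 0 < h / 2)); nra.
have R2 : g x - e <= g (x - h / 2).
  have H1 := sf (x - h / 2) (x - h) ltac:(lra) ltac:(lra).
  have H2 := sf x (x - h / 2) ltac:(lra) ltac:(lra).
  have H3 := sf x (x + h) ltac:(lra) ltac:(lra).
  rewrite -/g in H1 H2 H3.
  rewrite -(ler_pM2l (_ : 0 < h / 2)); nra.
near=> y.
have : `|x - y| <= h / 2.
  by near: y; apply: cvgr_dist_le; [exact: cvg_id|lra].
rewrite ler_norml => /andP[y1 y2].
have G1 := gm (x - h / 2) y ltac:(lra) ltac:(lra).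
have G2 := gm y (x + h / 2) ltac:(lra) ltac:(lra).
by rewrite ler_norml; apply/andP; split; lra.
Unshelve. all: by end_near. Qed.

End convex_real_functions.

(** * Concave functions with convex increments *)

Section concave_with_convex_increments.
Variables (R : realType) (W : R -> R).
Implicit Types x y z h p q t r e b : R.
Hypothesis W_ge0 : forall x, 0 <= x -> 0 <= W x.
Hypothesis W_nondec : forall x y, 0 <= x -> x <= y -> W x <= W y.
Hypothesis W_concave : forall x p q, 0 <= x -> 0 < p -> 0 < q ->
  q * W x + p * W (x + p + q) <= (p + q) * W (x + p).
Hypothesis W_second_diff : forall x y h, 0 < x -> 0 < y -> 0 < h ->
  y * x * (W (x + y + h) *+ 2 - W (x + y + h + h) - W (x + y)) <=
  h ^+ 2 * W (x + y).

Lemma derivable_of_second_diff : differentiable_on_pos W.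
Proof.
move=> x x0.
have cN : three_point_convex (\- W).
  move=> y z t y0 yz zt.
  have := @W_concave y (z - y) (t - z) ltac:(lra) ltac:(lra) ltac:(lra).
  have -> : y + (z - y) + (t - z) = t by ring.
  by rewrite subrKC => H; rewrite !mulrN; lra.
have flat : flat_second_diff (\- W) x.
  (* [d <= x / 2] gives [((x - d) / 2) ^ 2 >= x ^ 2 / 16], and the other bound makes
     [16 d W x / x ^ 2] at most [e]; the added 1 keeps the denominator positive. *)
  move=> e e0; pose d := Num.min (x / 2) (e * x ^+ 2 / (16 * (W x + 1))).
  have Wx1 : 0 < 16 * (W x + 1) by have := W_ge0 (ltW x0); lra.
  have x2 : 0 < x ^+ 2 by apply: exprn_gt0.
  have d0 : 0 < d by rewrite lt_min divr_gt0 //= divr_gt0 // mulr_gt0.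
  have d1 : d <= x / 2 by rewrite ge_min lexx.
  have d2 : d * (16 * (W x + 1)) <= e * x ^+ 2.
    by rewrite -ler_pdivlMr// ge_min lexx orbT.
  exists d; split=> //; first lra.
  have := @W_second_diff ((x - d) / 2) ((x - d) / 2) d ltac:(lra) ltac:(lra) d0.
  have -> : (x - d) / 2 + (x - d) / 2 = x - d by field.
  rewrite subrK => H.
  set D := W x *+ 2 - W (x + d) - W (x - d) in H *.
  suff : D <= e * d by rewrite /D /= !mulr2n; lra.
  have Wxd : W (x - d) <= W x by apply: W_nondec; lra.
  have [D0|D0] := lerP D 0; first by rewrite (le_trans D0)// mulr_ge0// ltW.
  have H1 : x ^+ 2 / 16 * D <= d ^+ 2 * W x.
    rewrite (le_trans (le_trans _ H))//.
      by rewrite ler_wpM2r ?(ltW D0)//; have := d1; have := d0; nra.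
    by rewrite ler_wpM2l// sqr_ge0.
  have H2 : d ^+ 2 * W x <= d * (e * x ^+ 2 / 16).
    rewrite expr2 -mulrA ler_wpM2l ?(ltW d0)//; nra.
  rewrite -(ler_pM2l (_ : 0 < x ^+ 2 / 16)); last lra.
  by apply: (le_trans H1); apply: (le_trans H2); lra.
have [/derivableN + _] := convex_derivable cN x0 flat.
by rewrite (_ : - (\- W) = W)//; apply/funext => y; rewrite /= !fctE opprK.
Qed.

Let incr_cvg x : 0 < x ->
  (fun h => h^-1 * (W (x + h) - W x)) @ 0^'+ --> W^`()%classic x.
Proof.
move=> x0; apply: cvg_dnbhs_at_right.
have := derivable_of_second_diff x0; rewrite /derivable /derive1.
under eq_fun do rewrite [_ *: 1]mulr1 /= [_ + x]addrC.
by under [in X in _ -> X]eq_fun do rewrite [_ + x]addrC.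
Qed.

Hypothesis W_convex_incr : forall x h p q, 0 < x -> 0 < h -> 0 < p -> 0 < q ->
  (p + q) * (W (x + p + h) - W (x + p)) <=
  q * (W (x + h) - W x) + p * (W (x + p + q + h) - W (x + p + q)).

Let derive_three_point : three_point_convex W^`()%classic.
Proof.
move=> x y z x0 xy yz.
apply: (@ler_cvg_to _ 0^'+ _ _
  (fun h => (z - x) * (h^-1 * (W (y + h) - W y)))
  (fun h => (z - y) * (h^-1 * (W (x + h) - W x))
            + (y - x) * (h^-1 * (W (z + h) - W z)))).
- by apply: cvgMl_tmp; apply: incr_cvg; lra.
- by apply: cvgD; apply: cvgMl_tmp; apply: incr_cvg; lra.
near=> h.
have h0 : 0 < h by [].
have := @W_convex_incr x h (y - x) (z - y) x0 h0 ltac:(lra) ltac:(lra).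
rewrite subrKC subrKC addrC subrKA => H.
have {}H := ler_wpM2l (ltW (_ : 0 < h^-1)) H.
rewrite !(mulrCA _ h^-1) -mulrDr; apply: H; by rewrite invr_gt0.
Unshelve. all: by end_near. Qed.

Lemma convex_derive_of_convex_incr : convex_on `]0, +oo[ W^`()%classic.
Proof. exact: three_point_convex_on. Qed.

Variable delta : R.
Hypothesis delta0 : 0 < delta.
Hypothesis W_linear : forall x, 0 <= x -> delta * W x <= x.
Hypothesis W_gt0 : forall x, 0 < x -> 0 < W x.
Hypothesis W_third_diff : forall y t h r, 0 < y -> 0 < t -> 0 < h -> 0 < r ->
  t * delta * ((W (y + t + r + h + h) - W (y + t + h + h))
               - (W (y + t + r + h) - W (y + t + h)) *+ 2
               + (W (y + t + r) - W (y + t))) <=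
  r * (t * (W h *+ 2 - W (h + h)) / W (y + t) + h ^+ 2 *+ 2 * delta^-1 / W y).

(* If [2 W(h) - W(2 h) > e h] for all small [h] then [W(h) / h] would increase
   by more than [e / 2] at each halving of [h], against [delta * W h <= h]. *)
Let small_second_diff_at0 e b : 0 < e -> 0 < b ->
  exists h, [/\ 0 < h, h <= b & W h *+ 2 - W (h + h) <= e * h].
Proof.
move=> e0 b0; apply: contrapT => /forallNP nex.
pose h k := b / 2 ^+ k.
have h0 k : 0 < h k by rewrite divr_gt0// exprn_gt0.
have hb k : h k <= b.
  by rewrite ler_pdivrMr ?exprn_gt0// ler_peMr ?(ltW b0)// exprn_ege1// ler1n.
have hS k : h k = h k.+1 + h k.+1 by rewrite /h exprS; field; rewrite expf_neq0.
have gt k : W (h k) + e * h k.+1 < W (h k.+1) *+ 2.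
  rewrite ltNge; apply/negP => H; apply: (nex (h k.+1)); split=> //.
  by rewrite -hS; lra.
have lb k : k%:R * (e / 2) * h k <= W (h k).
  elim: k => [|k IH]; first by rewrite !mul0r W_ge0// ltW.
  by move: IH (gt k); rewrite (hS k) -(natr1 k) (mulr2n (W _)); lra.
(* By [lb] and [delta * W h <= h], every [k] satisfies [k * e * delta <= 2]. *)
pose k := (Num.truncn (2 / (e * delta))).+1.
have : 2 / (e * delta) < k%:R by rewrite /k truncnS_gt.
rewrite ltr_pdivrMr ?mulr_gt0// => kb.
have := lb k; have := W_linear (ltW (h0 k)).
have := h0 k; set w := W (h k); set hk := h k => hk0 H1 H2.
have : delta * (k%:R * (e / 2) * hk) <= hk.
  by rewrite (le_trans _ H1)// ler_pM2l.
have : hk < delta * (k%:R * (e / 2) * hk).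
  have -> : delta * (k%:R * (e / 2) * hk) = (k%:R * (e * delta)) / 2 * hk by field.
  by rewrite ltr_pMl//; lra.
lra.
Qed.

(** Both sides of [W_third_diff] are of order [r]: dividing by [r] and letting it tend to 0 turns
    the increments of length [r] into derivatives. *)
Let derive_second_diff x h t y : 0 < h -> 0 < t -> 0 < y -> x = y + t + h ->
  t * delta * (W^`()%classic (x + h) - W^`()%classic x *+ 2 + W^`()%classic (x - h)) <=
  t * (W h *+ 2 - W (h + h)) / W (y + t) + h ^+ 2 *+ 2 * delta^-1 / W y.
Proof.
move=> h0 t0 y0 xE.
have -> : x - h = y + t by rewrite xE addrK.
set B := (X in _ <= X).
apply: (@ler_cvg_to _ 0^'+ _ _
  (fun r => t * delta * (r^-1 * (W (x + h + r) - W (x + h))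
    - (r^-1 * (W (x + r) - W x)) *+ 2 + r^-1 * (W (y + t + r) - W (y + t))))
  (fun=> B)).
- apply: cvgMl_tmp; apply: cvgD; last by apply: incr_cvg; lra.
  apply: cvgB; first by apply: incr_cvg; lra.
  by apply: cvgMn; apply: incr_cvg; lra.
- exact: cvg_cst.
near=> r.
have r0 : 0 < r by [].
have := W_third_diff y0 t0 h0 r0; rewrite -/B.
rewrite -(ler_pM2l (_ : 0 < r^-1)) ?invr_gt0// mulKf ?gt_eqF//.
have -> : y + t + r + h + h = x + h + r by rewrite xE; ring.
have -> : y + t + r + h = x + r by rewrite xE; ring.
rewrite -xE; apply: le_trans.
by rewrite le_eqVlt; apply/orP; left; apply/eqP; ring.
Unshelve. all: by end_near. Qed.

Lemma C2_of_third_diff : C2_on_pos W.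
Proof.
set g := W^`()%classic.
have flat x : 0 < x -> flat_second_diff g x.
  move=> x0 e e0; set Wx := W (x / 4).
  have Wx0 : 0 < Wx by apply: W_gt0; lra.
  (* [derive_second_diff] is used with [y = x / 4] and [t = 3 x / 4 - h], which is at least [x / 4]
     as [h <= x / 2]. The values of [e1] and [b] make each of its two terms at most half of
     [t * delta * (e * h)]. *)
  pose e1 := e * delta * Wx / 2.
  pose b := Num.min (x / 2) (e * delta ^+ 2 * x * Wx / 16).
  have ed : 0 < e * delta by rewrite mulr_gt0.
  have e10 : 0 < e1 by rewrite /e1 divr_gt0// mulr_gt0.
  have edx : 0 < e * delta ^+ 2 * x * Wx by rewrite !mulr_gt0// exprn_gt0.
  have b0 : 0 < b by rewrite lt_min !divr_gt0.
  have [h [h0 hb hW]] := small_second_diff_at0 e10 b0.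
  have hx : h <= x / 2 by rewrite (le_trans hb)// ge_min lexx.
  have h2 : h <= e * delta ^+ 2 * x * Wx / 16.
    by rewrite (le_trans hb)// ge_min lexx orbT.
  exists h; split=> //; first lra.
  pose t := x - h - x / 4.
  have t4 : x / 4 <= t by rewrite /t; lra.
  have t0 : 0 < t by lra.
  have := @derive_second_diff x h t (x / 4) h0 t0 ltac:(lra).
  move=> /(_ ltac:(rewrite /t; ring)); rewrite -/g -/Wx => H.
  rewrite -(ler_pM2l (_ : 0 < t * delta)) ?mulr_gt0//; apply: (le_trans H).
  have Wt : Wx <= W (x / 4 + t) by apply: W_nondec; lra.
  have A1 : t * (W h *+ 2 - W (h + h)) / W (x / 4 + t) <= t * delta * (e / 2 * h).
    rewrite ler_pdivrMr; last exact: lt_le_trans Wt.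
    apply: (@le_trans _ _ (t * delta * (e / 2 * h) * Wx)); last first.
      by rewrite ler_wpM2l// !mulr_ge0// ?ltW// divr_gt0.
    have := ler_wpM2l (ltW t0) hW; rewrite /e1; lra.
  have A2 : h ^+ 2 *+ 2 * delta^-1 / Wx <= t * delta * (e / 2 * h).
    rewrite ler_pdivrMr// ler_pdivrMr//.
    apply: (@le_trans _ _ (x / 4 * delta * (e / 2 * h) * Wx * delta)).
      have -> : x / 4 * delta * (e / 2 * h) * Wx * delta =
        h * (e * delta ^+ 2 * x * Wx / 16) *+ 2 by field.
      by rewrite lerMn2r expr2 ler_wpM2l// ltW.
    have eh0 : 0 < e / 2 * h by rewrite mulr_gt0// divr_gt0.
    by rewrite ler_pM2r// ler_pM2r// ler_pM2r// ler_pM2r.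
  by apply: (le_trans (lerD A1 A2)); lra.
have sub : subgradient g.
  by move=> x y x0 y0; have [_] := convex_derivable derive_three_point x0 (flat x x0); exact.
split; first exact: derivable_of_second_diff.
  by move=> x x0; have [] := convex_derivable derive_three_point x0 (flat x x0).
by move=> x x0; exact: (convex_continuous_derive sub x0 (flat x x0)).
Qed.

End concave_with_convex_increments.

(** * Power series *)

Section power_series.
Variable R : realType.
Implicit Types (a b u : nat -> R) (z : R).

Lemma triangular_sum (F : nat -> nat -> R) N :
  \sum_(n < N) \sum_(i < n.+1) F i (n - i)%N =
  \sum_(i < N) \sum_(j < N - i) F i j.
Proof.
elim: N => [|N IH]; first by rewrite !big_ord0.
rewrite big_ord_recr IH [RHS]big_ord_recr /= subSnn big_ord1.
rewrite big_ord_recr /= subnn addrA -big_split /=; congr (_ + _).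
by apply: eq_bigr => i _; rewrite subSn ?(ltnW (ltn_ord i))// big_ord_recr.
Qed.

(** The triangle of side [N] lies in the square of side [N], itself contained in the triangle of
    side [2 N]. For nonnegative terms the partial sums are ordered accordingly. *)
Lemma cvg_cauchy_product a b (A B : R) : (forall n, 0 <= a n) ->
  (forall n, 0 <= b n) -> series a @ \oo --> A -> series b @ \oo --> B ->
  series (fun n => \sum_(i < n.+1) a i * b (n - i)%N) @ \oo --> A * B.
Proof.
move=> a0 b0 aA bB; set p := fun n => _; pose P := series p.
have sumE (f : nat -> R) N : series f N = \sum_(i < N) f i.
  by rewrite /series /= big_mkord.
have PE N : P N = \sum_(i < N) \sum_(j < N - i) a i * b j.
  by rewrite /P sumE (triangular_sum (fun i j => a i * b j)).
have p0 n : 0 <= p n by apply: sumr_ge0 => i _; exact: mulr_ge0.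
have Pnd : nondecreasing_seq P.
  by apply/nondecreasing_seqP => n; rewrite /P seriesSr lerDl.
have le1 N : P N <= series a N * series b N.
  rewrite PE !sumE mulr_suml; apply: ler_sum => i _.
  rewrite mulr_sumr [leRHS](bigID (fun j : 'I_N => (j < N - i)%N)) /=.
  rewrite (big_ord_widen _ (fun j => a i * b j) (leq_subr i N)) lerDl.
  by apply: sumr_ge0 => j _; exact: mulr_ge0.
have le2 N : series a N * series b N <= P (N + N)%N.
  rewrite PE !sumE mulr_suml big_split_ord /= -[leLHS]addr0 lerD//; last first.
    by apply: sumr_ge0 => i _; apply: sumr_ge0 => j _; exact: mulr_ge0.
  apply: ler_sum => i _; rewrite mulr_sumr.
  have Ni : (N <= N + N - i)%N by have := ltn_ord i; lia.
  rewrite (big_ord_widen _ (fun j => a i * b j) Ni).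
  rewrite [leRHS](bigID (fun j : 'I__ => (j < N)%N)) /= lerDl.
  by apply: sumr_ge0 => j _; exact: mulr_ge0.
have le_lim (f : nat -> R) l : (forall n, 0 <= f n) -> series f @ \oo --> l ->
    forall n, series f n <= l.
  move=> f0 fl n; rewrite -(cvg_lim _ fl)//; apply: nondecreasing_cvgn_le.
    by apply/nondecreasing_seqP => m; rewrite seriesSr lerDl.
  by apply/cvg_ex; exists l.
have s0 (f : nat -> R) n : (forall k, 0 <= f k) -> 0 <= series f n.
  by move=> f0; rewrite sumE; apply: sumr_ge0.
have Pub : has_ubound (range P).
  exists (A * B) => _ [n _ <-]; apply: (le_trans (le1 n)).
  by apply: ler_pM; [exact: s0|exact: s0|exact: le_lim|exact: le_lim].
have Pcvg : cvgn P by exact: nondecreasing_is_cvgn.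
suff -> : A * B = limn P by [].
have abAB : (fun n => series a n * series b n) @ \oo --> A * B by exact: cvgM.
apply/eqP; rewrite eq_le; apply/andP; split.
  apply: (@ler_cvg_to _ \oo _ _ _ (fun=> limn P) _ _ abAB (cvg_cst _)).
  by near=> n; rewrite (le_trans (le2 n))//; exact: nondecreasing_cvgn_le.
by apply: (@ler_cvg_to _ \oo _ _ _ _ _ _ Pcvg abAB); near=> n.
Unshelve. all: by end_near. Qed.

(** Convergence at 1/2 gives [|a n| <= C 2 ^ n]. If the coefficients below [N] vanish, then for
    [z <= 1 / 4] the terms after [N] are dominated by a geometric series of ratio 1/2 and of order
    [z ^ N.+1]. Dividing by [z ^ N] and taking [z] small yields [a N = 0]. *)
Lemma pseries_eq0 a : (forall z, 0 < z -> z < 1 -> pseries a z @ \oo --> (0 : R)) ->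
  forall n, a n = 0.
Proof.
move=> a0.
have sumE z N : pseries a z N = \sum_(i < N) a i * z ^+ i.
  by rewrite /pseries /series /= big_mkord.
have [C C0 aC] : exists2 C, 0 <= C & forall n, `|a n| * 2^-1 ^+ n <= C.
  have h1 : 0 < 2^-1 :> R by rewrite invr_gt0.
  have h2 : 2^-1 < 1 :> R by rewrite invf_lt1// ltr1n.
  have : cvgn (pseries a 2^-1) by apply/cvg_ex; exists 0; exact: a0.
  move=> /cvg_series_cvg_0/cvgP/cvg_seq_bounded [M [_ /(_ (`|M| + 1))]].
  move=> /(_ ltac:(by rewrite ltr_pwDr// ler_norm)) H.
  exists (`|M| + 1); first by rewrite addr_ge0.
  by move=> n; have := H n I; rewrite /= normrM normrX (gtr0_norm h1).
elim/ltn_ind => N IH.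
have key z : 0 < z -> z <= 4^-1 -> `|a N| <= 2 * C * 2 ^+ N.+1 * z.
  move=> z0 z4; have z1 : z < 1 by apply: (le_lt_trans z4); rewrite invf_lt1// ltr1n.
  rewrite -(ler_pM2r (exprn_gt0 N z0)).
  have tail M : `|pseries a z (N + M.+1)%N - a N * z ^+ N| <=
      2 * C * 2 ^+ N.+1 * z * z ^+ N.
    have -> : pseries a z (N + M.+1)%N - a N * z ^+ N =
        \sum_(i < M) a (N.+1 + i)%N * z ^+ (N.+1 + i)%N.
      rewrite sumE big_split_ord /= big1 ?add0r; last first.
        by move=> i _; rewrite IH ?mul0r.
      rewrite big_ord_recl /= addn0 addrAC subrr add0r; apply: eq_bigr => i _.
      by rewrite /bump /= add1n addnS addSn.
    rewrite (le_trans (ler_norm_sum _ _ _))//.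
    apply: (@le_trans _ _ (\sum_(i < M) C * (2 * z) ^+ N.+1 * 2^-1 ^+ i)).
      apply: ler_sum => i _; rewrite normrM normrX (gtr0_norm z0).
      have -> : z ^+ (N.+1 + i) = 2^-1 ^+ (N.+1 + i) * (2 * z) ^+ (N.+1 + i).
        by rewrite -exprMn mulrA mulVf ?mul1r.
      rewrite mulrA (exprD (2 * z)) mulrA; apply: ler_pM.
      - by rewrite mulr_ge0 ?mulr_ge0 ?exprn_ge0//; lra.
      - by rewrite exprn_ge0//; lra.
      - by rewrite ler_wpM2r ?exprn_ge0//; lra.
      - by apply: lerXn2r; rewrite ?nnegrE; lra.
    rewrite -mulr_sumr.
    have geo : \sum_(i < M) 2^-1 ^+ i <= 2 :> R.
      suff -> : \sum_(i < M) 2^-1 ^+ i = 2 - 2 * 2^-1 ^+ M :> R.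
        by have := exprn_ge0 M (_ : 0 <= 2^-1 :> R); lra.
      by elim: M => [|M IHM]; rewrite ?big_ord0 ?expr0 ?big_ord_recr/= ?IHM ?exprS; lra.
    apply: (le_trans (ler_wpM2l _ geo)); first by rewrite mulr_ge0// exprn_ge0//; lra.
    by rewrite le_eqVlt; apply/orP; left; apply/eqP; rewrite exprMn [z ^+ N.+1]exprS; ring.
  have cv : `|pseries a z M - a N * z ^+ N| @[M --> \oo] --> `|a N| * z ^+ N.
    have -> : `|a N| * z ^+ N = `|0 - a N * z ^+ N|.
      by rewrite sub0r normrN normrM normrX (gtr0_norm z0).
    by apply: cvg_norm; apply: cvgB; [exact: a0|exact: cvg_cst].
  have cB : (fun=> 2 * C * 2 ^+ N.+1 * z * z ^+ N) @ \oo --> 2 * C * 2 ^+ N.+1 * z * z ^+ N.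
    exact: cvg_cst.
  apply: (ler_cvg_to cv cB).
  near=> M; have NM : (N < M)%N by near: M; exists N.+1.
  by have := tail (M - N.+1)%N; rewrite (_ : (N + (M - N.+1).+1)%N = M)//; lia.
apply/eqP; rewrite -normr_le0 leNgt; apply/negP => aN.
pose K := 2 * C * 2 ^+ N.+1.
have K0 : 0 <= K by rewrite /K !mulr_ge0// exprn_ge0.
pose z := Num.min 4^-1 (`|a N| / (2 * (K + 1))).
have K1 : 0 < 2 * (K + 1) by lra.
have z0 : 0 < z by rewrite lt_min invr_gt0 ltr0n/= divr_gt0.
have z4 : z <= 4^-1 by rewrite ge_min lexx.
have zK : z * (2 * (K + 1)) <= `|a N| by rewrite -ler_pdivlMr// ge_min lexx orbT.
by have := key z z0 z4; rewrite -/K; lra.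
Unshelve. all: by end_near. Qed.

Lemma pseries_inj a b (S : R -> R) :
  (forall z, 0 < z -> z < 1 -> pseries a z @ \oo --> S z) ->
  (forall z, 0 < z -> z < 1 -> pseries b z @ \oo --> S z) ->
  a =1 b.
Proof.
move=> aS bS n; apply/eqP; rewrite -subr_eq0; apply/eqP.
apply: (@pseries_eq0 (fun n => a n - b n)) => z z0 z1.
rewrite (_ : pseries _ z = fun N => pseries a z N - pseries b z N).
  by rewrite -(subrr (S z)); apply: cvgB; [exact: aS|exact: bS].
apply/funext => N; rewrite /pseries /series /= -sumrB.
by apply: eq_bigr => i _; rewrite mulrBl.
Qed.

Lemma pseries_geometric z : 0 < z -> z < 1 -> pseries (fun=> 1) z @ \oo --> (1 - z)^-1.
Proof.
move=> z0 z1; rewrite -div1r.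
by apply: cvg_geometric_series; rewrite gtr0_norm.
Qed.

(** Comparison of the coefficients in [c U = 1 / (1 - z) + z A U]. At [n = 0] the sum is empty, so
    the truncated [n.-1] is harmless. *)
Lemma renewal_equation a u (c : R) (A U : R -> R) :
  (forall n, 0 <= a n) -> (forall n, 0 <= u n) ->
  (forall z, 0 < z -> z < 1 -> pseries a z @ \oo --> A z) ->
  (forall z, 0 < z -> z < 1 -> pseries u z @ \oo --> U z) ->
  (forall z, 0 < z -> z < 1 -> (1 - z) * U z * (c - z * A z) = 1) ->
  forall n, c * u n = 1 + \sum_(i < n) a i * u (n.-1 - i)%N.
Proof.
move=> a0 u0 aA uU AU.
apply: (@pseries_inj _ _ (fun z => c * U z)) => z z0 z1.
  rewrite (_ : pseries _ z = fun N => c * pseries u z N).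
    by apply: cvgMl_tmp; exact: uU.
  apply/funext => N; rewrite /pseries /series /= mulr_sumr.
  by apply: eq_bigr => i _; rewrite mulrA.
have -> : c * U z = (1 - z)^-1 + z * (A z * U z).
  have z1' : 1 - z != 0 by rewrite subr_eq0 eq_sym lt_eqF.
  have -> : (1 - z)^-1 = U z * (c - z * A z).
    by apply: (mulfI z1'); rewrite mulfV// mulrA AU.
  by ring.
have := cvg_cauchy_product _ _ (aA z z0 z1) (uU z z0 z1).
move=> /(_ (fun n => mulr_ge0 (a0 n) (exprn_ge0 n (ltW z0)))).
move=> /(_ (fun n => mulr_ge0 (u0 n) (exprn_ge0 n (ltW z0)))).
move=> H.
have H1 : (fun N => pseries (fun=> 1) z N.+1) @ \oo --> (1 - z)^-1.
  by rewrite (cvg_shiftS (pseries _ z)); exact: pseries_geometric.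
set r := fun n => _; rewrite -(cvg_shiftS (pseries r z)) /=.
rewrite (_ : (fun N => pseries r z N.+1) = fun N => pseries (fun=> 1) z N.+1 +
   z * series (fun n => \sum_(i < n.+1) a i * z ^+ i * (u (n - i)%N * z ^+ (n - i))) N).
  by apply: cvgD; [exact: H1|apply: cvgMl_tmp; exact: H].
apply/funext => N; rewrite /r /pseries /series /=.
rewrite !big_mkord [LHS]big_ord_recl /= big_ord0 addr0 [in RHS]big_ord_recl /= -addrA.
congr (_ + _); rewrite mulr_sumr -big_split /=; apply: eq_bigr => i _.
rewrite /bump /= add1n mulrDl; congr (_ + _).
rewrite mulr_suml mulr_sumr; apply: eq_bigr => j _.
have -> : z ^+ i.+1 = z * (z ^+ j * z ^+ (i - j)).
  by rewrite -exprD exprS subnKC// -ltnS.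
by ring.
Qed.

End power_series.

(** * Poisson transforms *)

Section integral_of_power_series.
Context {d : measure_display} {T : measurableType d} {R : realType}.
Variables (mu : {measure set T -> \bar R}) (D : set T).
Hypothesis mD : measurable D.
Variables (F : nat -> T -> R) (H : T -> R) (z : R).
Hypothesis mF : forall n, measurable_fun D (F n).
Hypothesis F_ge0 : forall n x, D x -> 0 <= F n x.
Hypothesis z_gt0 : 0 < z.
Hypothesis FH : forall x, D x -> pseries (fun n => F n x) z @ \oo --> H x.
Hypothesis H_fin : (\int[mu]_(x in D) (H x)%:E < +oo)%E.

Let mFz n : measurable_fun D (fun x => (F n x * z ^+ n)%:E : \bar R).
Proof. by apply/measurable_EFinP; apply: measurable_funM. Qed.

Let Fz_ge0 n x : D x -> (0 <= (F n x * z ^+ n)%:E)%E.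
Proof. by move=> Dx; rewrite lee_fin mulr_ge0 ?F_ge0// exprn_ge0// ltW. Qed.

(** Monotone convergence, the terms being nonnegative. *)
Let HE : (\int[mu]_(x in D) (H x)%:E =
  \sum_(0 <= n <oo) \int[mu]_(x in D) (F n x * z ^+ n)%:E)%E.
Proof.
rewrite -integral_nneseries//; apply: eq_integral => x /set_mem Dx.
rewrite -(cvg_lim _ (FH Dx))// -EFin_lim; last by apply/cvgP; exact: FH.
by congr (limn _); apply/funext => n /=; rewrite /series /= -sumEFin.
Qed.

Let IFz n : (\int[mu]_(x in D) (F n x * z ^+ n)%:E =
  (z ^+ n)%:E * \int[mu]_(x in D) (F n x)%:E)%E.
Proof.
rewrite -ge0_integralZl//; first by apply: eq_integral => x _; rewrite mulrC EFinM.
- exact/measurable_EFinP.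
- by move=> x Dx; rewrite lee_fin F_ge0.
- by rewrite lee_fin exprn_ge0// ltW.
Qed.

Lemma integral_coeff_lty n : (\int[mu]_(x in D) (F n x)%:E < +oo)%E.
Proof.
rewrite -(@lte_pmul2l _ (z ^+ n)%:E)// ?lte_fin ?exprn_gt0//.
rewrite mulry gtr0_sg ?exprn_gt0// mul1e -IFz; apply: le_lt_trans H_fin.
rewrite HE; apply: (@le_trans _ _ (\sum_(0 <= i < n.+1)
    \int[mu]_(x in D) (F i x * z ^+ i)%:E)%E).
  rewrite big_nat_recr//= leeDr// sume_ge0// => i _.
  by apply: integral_ge0 => x; exact: Fz_ge0.
by apply: nneseries_lim_ge => i _ _; apply: integral_ge0 => x; exact: Fz_ge0.
Qed.

Lemma pseries_integral :
  pseries (fun n => \int[mu]_(x in D) F n x) z @ \oo --> \int[mu]_(x in D) H x.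
Proof.
have Ifin n : (\int[mu]_(x in D) (F n x)%:E)%E \is a fin_num.
  rewrite ge0_fin_numE ?integral_coeff_lty//.
  by apply: integral_ge0 => x Dx; rewrite lee_fin F_ge0.
rewrite -[pseries _ z]/(fine \o (EFin \o pseries _ z)); apply: fine_cvg.
have -> : EFin \o pseries (fun n => \int[mu]_(x in D) F n x) z =
    fun N => (\sum_(0 <= n < N) \int[mu]_(x in D) (F n x * z ^+ n)%:E)%E.
  apply/funext => N /=; rewrite /pseries /series /= -sumEFin.
  by apply: eq_bigr => n _; rewrite IFz EFinM muleC /Rintegral fineK.
have H0 : (\int[mu]_(x in D) (H x)%:E)%E \is a fin_num.
  rewrite ge0_fin_numE// HE; apply: nneseries_ge0 => i _ _.
  by apply: integral_ge0 => x; exact: Fz_ge0.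
rewrite /Rintegral fineK// HE; apply: is_cvg_nneseries => n _ _.
by apply: integral_ge0 => x; exact: Fz_ge0.
Qed.

End integral_of_power_series.

Section poisson_kernel.
Variable R : realType.
Implicit Types (lam s z : R) (n : nat).

(** The probability that a Poisson variable of mean [lam * s] equals [n]. *)
Definition poisson_kernel lam n s := expR (- (lam * s)) * ((lam * s) ^+ n / n`!%:R).

Lemma poisson_kernel_ge0 lam n s : 0 <= lam -> 0 <= s -> 0 <= poisson_kernel lam n s.
Proof.
by move=> l0 s0; rewrite mulr_ge0 ?expR_ge0// divr_ge0// exprn_ge0// mulr_ge0.
Qed.

Lemma measurable_poisson_kernel lam n D : measurable_fun D (poisson_kernel lam n).
Proof.
apply: (@measurable_funS _ _ _ _ setT) => //.
apply: continuous_measurable_fun => s; apply: cvgM.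
  apply: continuous_comp; last exact: continuous_expR.
  by apply: cvgN; apply: cvgM; [exact: cvg_cst|exact: cvg_id].
apply: cvgM; last exact: cvg_cst.
apply: (@continuous_comp _ _ _ _ (fun x : R => x ^+ n)); last exact: exprn_continuous.
by apply: cvgM; [exact: cvg_cst|exact: cvg_id].
Qed.

Lemma pseries_poisson_kernel lam s z :
  pseries (fun n => poisson_kernel lam n s) z @ \oo --> expR (- (lam * (1 - z) * s)).
Proof.
have -> : - (lam * (1 - z) * s) = - (lam * s) + lam * s * z by ring.
rewrite expRD (_ : pseries _ z = fun N =>
    expR (- (lam * s)) * series (exp_coeff (lam * s * z)) N).
  by apply: cvgMl_tmp; exact: is_cvg_series_exp_coeff.
apply/funext => N; rewrite /pseries /series /= mulr_sumr; apply: eq_bigr => n _.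
by rewrite /poisson_kernel /exp_coeff /= !exprMn; ring.
Qed.

End poisson_kernel.

Section nonneg_integrable.
Context {d : measure_display} {T : measurableType d} {R : realType}.
Variables (m : {measure set T -> \bar R}) (D : set T).
Hypothesis mD : measurable D.

Lemma ge0_integrable (f : T -> R) : measurable_fun D f ->
  (forall x, D x -> 0 <= f x) -> (\int[m]_(x in D) (f x)%:E < +oo)%E ->
  m.-integrable D (EFin \o f).
Proof.
move=> mf f0 fy; apply/integrableP; split; first exact/measurable_EFinP.
rewrite (le_lt_trans _ fy)// le_eqVlt; apply/orP; left; apply/eqP.
by apply: eq_integral => x /set_mem Dx /=; rewrite ger0_norm// f0.
Qed.

Lemma EFin_Rintegral (f : T -> R) : m.-integrable D (EFin \o f) ->
  (\int[m]_(x in D) f x)%:E = (\int[m]_(x in D) (f x)%:E)%E.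
Proof.
by move=> fi; rewrite /Rintegral fineK//; exact: (integrable_fin_num mD fi).
Qed.

End nonneg_integrable.

Section poisson_transform.
Variable R : realType.
Implicit Types (lam s z a b : R) (n : nat) (f g : R -> R).

Local Notation mu := (@lebesgue_measure R).
Local Notation D := (`]0, +oo[%classic : set R).

Let mD : measurable D. Proof. exact: measurable_itv. Qed.

Let D0 s : D s -> 0 < s. Proof. by rewrite /= in_itv/= andbT. Qed.

Lemma measurable_exprMl (D : set R) a : measurable_fun D (fun s => expR (a * s)).
Proof.
apply: (@measurable_funS _ _ _ _ setT) => //.
apply: continuous_measurable_fun => s.
apply: continuous_comp; last exact: continuous_expR.
by apply: cvgM; [exact: cvg_cst|exact: cvg_id].
Qed.

Lemma measurable_expRN (D : set R) a : measurable_fun D (fun s => expR (- (a * s))).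
Proof.
by under eq_fun do rewrite -mulNr; exact: measurable_exprMl.
Qed.

Lemma integral_expRN a : 0 < a ->
  (\int[mu]_(s in D) (expR (- (a * s)))%:E = (a^-1)%:E)%E.
Proof.
move=> a0; have := integral_exponential_pdf a0.
have -> : (\int[mu]_x (exponential_pdf a x)%:E =
    \int[mu]_(s in `[0%R, +oo[) (a * expR (- (a * s)))%:E)%E.
  rewrite [RHS]integral_mkcond; apply: eq_integral => x _.
  by rewrite /exponential_pdf /patch; case: ifP; rewrite ?mulNr.
rewrite -integral_itv_obnd_cbnd; last first.
  apply/measurable_EFinP; apply: measurable_funM; first exact: measurable_cst.
  exact: measurable_expRN.
under eq_integral do rewrite EFinM.
rewrite ge0_integralZl//.
- move=> /(congr1 (fun x => (a^-1)%:E * x)%E).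
  by rewrite /= muleA -EFinM mulVf ?gt_eqF// mul1e mule1 => <-.
- by apply/measurable_EFinP; exact: measurable_expRN.
- by rewrite lee_fin ltW.
Qed.

Section transform.
Variables (lam : R) (f : R -> R).
Hypothesis lam0 : 0 < lam.
Hypothesis mf : measurable_fun D f.
Hypothesis f_ge0 : forall s, D s -> 0 <= f s.
Hypothesis f_laplace : forall t, 0 < t ->
  (\int[mu]_(s in D) (expR (- (t * s)) * f s)%:E < +oo)%E.

Let F n s := poisson_kernel lam n s * f s.

Let mF n : measurable_fun D (F n).
Proof. by apply: measurable_funM => //; exact: measurable_poisson_kernel. Qed.

Let F_ge0 n s : D s -> 0 <= F n s.
Proof.
move=> Ds; have s0 := D0 Ds.
by rewrite mulr_ge0 ?f_ge0// poisson_kernel_ge0 ?ltW.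
Qed.

Let FH z s : D s -> pseries (fun n => F n s) z @ \oo --> expR (- (lam * (1 - z) * s)) * f s.
Proof.
move=> Ds; rewrite (_ : pseries _ z =
    fun N => pseries (fun n => poisson_kernel lam n s) z N * f s).
  by apply: cvgMr_tmp; exact: pseries_poisson_kernel.
apply/funext => N; rewrite /pseries /series /= mulr_suml.
by apply: eq_bigr => i _; rewrite /F mulrAC.
Qed.

Lemma poisson_transform_integrable n :
  mu.-integrable D (EFin \o (fun s => poisson_kernel lam n s * f s)).
Proof.
apply: ge0_integrable => //; first exact: mF.
  by move=> s; exact: F_ge0.
have h : 0 < 2^-1 :> R by rewrite invr_gt0.
have := @integral_coeff_lty _ _ R mu D mD F _ _ mF F_ge0 h (@FH 2^-1).
move=> /(_ _ n); apply.
by apply: f_laplace; rewrite mulr_gt0//; lra.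
Qed.

Lemma pseries_poisson_transform z : 0 < z -> z < 1 ->
  pseries (fun n => \int[mu]_(s in D) (poisson_kernel lam n s * f s)) z @ \oo -->
  \int[mu]_(s in D) (expR (- (lam * (1 - z) * s)) * f s).
Proof.
move=> z0 z1; have := @pseries_integral _ _ R mu D mD F _ _ mF F_ge0 z0 (@FH z).
apply.
by apply: f_laplace; rewrite mulr_gt0//; lra.
Qed.

End transform.

Lemma integrable_poisson_kernel lam n : 0 < lam ->
  mu.-integrable D (EFin \o poisson_kernel lam n).
Proof.
move=> l0; have := @poisson_transform_integrable lam (fun=> 1) l0 (measurable_cst _).
move=> /(_ (fun _ _ => ler01)) H; have {H} := H _ n.
rewrite (_ : (fun s => _ * 1) = poisson_kernel lam n); last first.
  by apply/funext => s; rewrite mulr1.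
apply => t t0; under eq_integral do rewrite mulr1.
by rewrite integral_expRN// ltry.
Qed.

(** The Gamma integral without integration by parts: the generating function of the left side is the
    integral of [exp (- lam (1 - z) s)], that is, [lam^-1] times the geometric series. *)
Lemma Rintegral_poisson_kernel lam n : 0 < lam ->
  \int[mu]_(s in D) poisson_kernel lam n s = lam^-1.
Proof.
move=> l0; apply: (@pseries_inj _ (fun n => \int[mu]_(s in D) poisson_kernel lam n s)
  (fun=> lam^-1) (fun z => lam^-1 * (1 - z)^-1)) => z z0 z1.
  have := @pseries_poisson_transform lam (fun=> 1) l0 (measurable_cst _).
  move=> /(_ (fun _ _ => ler01)) H; have {H} := H _ z z0 z1.
  under eq_Rintegral do rewrite mulr1.
  rewrite {2}/Rintegral integral_expRN ?mulr_gt0 ?subr_gt0//= invfM.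
  rewrite (_ : (fun n => _) = fun n => \int[mu]_(s in D) poisson_kernel lam n s).
    apply => t t0; under eq_integral do rewrite mulr1.
    by rewrite integral_expRN// ltry.
  by apply/funext => k; apply: eq_Rintegral => s _; rewrite mulr1.
rewrite (_ : pseries _ z = fun N => lam^-1 * pseries (fun=> 1) z N).
  by apply: cvgMl_tmp; exact: pseries_geometric.
apply/funext => N; rewrite /pseries /series /= mulr_sumr.
by apply: eq_bigr => i _; rewrite mul1r.
Qed.

(** Exponential tilting only changes the rate. Hence the Poisson transform of an exponential is a
    geometric sequence, the equality case of log convexity. *)
Lemma poisson_kernel_expRN lam b n s : lam + b != 0 ->
  poisson_kernel lam n s * expR (- (b * s)) =
  (lam / (lam + b)) ^+ n * poisson_kernel (lam + b) n s.
Proof.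
move=> lb; rewrite /poisson_kernel.
have -> : - ((lam + b) * s) = - (lam * s) + - (b * s) by ring.
rewrite expRD expr_div_n !exprMn; field.
by rewrite expf_neq0//= pnatr_eq0 -lt0n fact_gt0.
Qed.

End poisson_transform.

(** * Log convexity of Poisson transforms *)

Section poisson_transform_log_convex.
Variable R : realType.
Implicit Types (s a b : R).

Local Notation mu := (@lebesgue_measure R).
Local Notation D := (`]0, +oo[%classic : set R).

Let mD : measurable (D : set (measurableTypeR R)). Proof. exact: measurable_itv. Qed.

Let D0 s : D s -> 0 < s. Proof. by rewrite /= in_itv/= andbT. Qed.

Variables (lam : R) (g : R -> R).
Hypothesis lam0 : 0 < lam.
Hypothesis g_gt0 : forall s, 0 < s -> 0 < g s.
Hypothesis g_noninc : forall s t, 0 < s -> s <= t -> g t <= g s.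
Hypothesis g_log_convex : three_point_convex (fun s => ln (g s)).

Let K n := poisson_kernel lam n.
Let p n := \int[mu]_(s in D) (K n s * g s).

(** If the integral were zero, the positive integrand would vanish almost everywhere on a set of
    infinite measure. *)
Lemma poisson_transform_gt0 n :
  mu.-integrable D (EFin \o (fun s => K n s * g s)) -> 0 < p n.
Proof.
move=> Ig; have F0 s : D s -> 0 < K n s * g s.
  move=> /D0 s0; rewrite mulr_gt0 ?g_gt0//.
  by rewrite mulr_gt0 ?expR_gt0// divr_gt0 ?ltr0n ?fact_gt0// exprn_gt0// mulr_gt0.
rewrite lt_neqAle; apply/andP; split; last first.
  by apply: Rintegral_ge0 => s Ds; rewrite ltW// F0.
apply/eqP => p0.
have := EFin_Rintegral mD Ig; rewrite -/(p n) -p0 => I0.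
have : (\int[mu]_(s in D) `|(K n s * g s)%:E| = 0)%E.
  rewrite [RHS]I0; apply: eq_integral => s /set_mem Ds /=.
  by rewrite gtr0_norm// F0.
move=> /(ae_eq_integral_abs mu mD (measurable_int mu Ig)) ae0.
have : mu D = 0%E.
  apply: (measure_negligible mD); apply: negligibleS ae0 => s Ds /= /(_ Ds) [].
  by apply/eqP; rewrite gt_eqF// F0.
by rewrite lebesgue_measure_itv/= ltry.
Qed.

(** The exponential is the chord of [ln (g s)] through [s1] and [s2]. A convex function is below its
    chord between the two points and above it outside, which is the sign of [(s - s1) (s - s2)].
    Monotonicity of [g] gives [b >= 0], so that the tilted rate [lam + b] is positive. *)
Lemma exp_chord s1 s2 : 0 < s1 -> s1 < s2 -> exists A b, [/\ 0 < A, 0 <= b &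
  forall s, 0 < s -> 0 <= (g s - A * expR (- (b * s))) * ((s - s1) * (s - s2))].
Proof.
move=> s10 s12; have s20 : 0 < s2 by apply: lt_trans s12.
pose b := (ln (g s1) - ln (g s2)) / (s2 - s1).
have d0 : 0 < s2 - s1 by rewrite subr_gt0.
have b0 : 0 <= b.
  apply: divr_ge0; last exact: ltW.
  rewrite subr_ge0 ler_ln ?posrE ?g_gt0//.
  by apply: g_noninc => //; exact: ltW.
exists (expR (ln (g s1) + b * s1)), b; split => //; first exact: expR_gt0.
move=> s s0; rewrite -expRD -[g s]lnK ?posrE ?g_gt0//.
have bE : b * (s2 - s1) = ln (g s1) - ln (g s2) by rewrite divfK// gt_eqF.
have sgn (x y t : R) : 0 <= (x - y) * t -> 0 <= (expR x - expR y) * t.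
  have [t0|t0|->] := ltgtP t 0; last by rewrite !mulr0.
    by rewrite !nmulr_lge0// !subr_le0 ler_expR.
  by rewrite !pmulr_lge0// !subr_ge0 ler_expR.
apply: sgn; rewrite -(pmulr_rge0 _ d0) [leRHS]mulrA.
have key : (s2 - s1) * (ln (g s) - (ln (g s1) + b * s1 + - (b * s))) =
   (s2 - s1) * ln (g s) - (s2 - s) * ln (g s1) - (s - s1) * ln (g s2).
  have -> : (s2 - s1) * (ln (g s) - (ln (g s1) + b * s1 + - (b * s))) =
    (s2 - s1) * (ln (g s) - ln (g s1)) + (b * (s2 - s1)) * (s - s1) by ring.
  by rewrite bE; ring.
rewrite key; have [ss1|ss1|->] := ltgtP s s1; last by rewrite !subrr !(mul0r, mulr0).
  have H := g_log_convex s0 ss1 s12.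
  by apply: mulr_ge0; [lra|apply: mulr_le0; lra].
have [ss2|ss2|->] := ltgtP s s2; last by rewrite !subrr !(mul0r, mulr0).
  have H := g_log_convex s10 ss1 ss2.
  by apply: mulr_le0; [lra|apply: mulr_ge0_le0; lra].
have H := g_log_convex s10 s12 ss2.
by apply: mulr_ge0; [lra|apply: mulr_ge0; lra].
Qed.

Variable n : nat.
Hypothesis Ig : forall i, (i <= 2)%N ->
  mu.-integrable D (EFin \o (fun s => K (n + i)%N s * g s)).

Let quad a (h : R -> R) s :=
  K n s * h s + (- (2 * a) * (K n.+1 s * h s) + a ^+ 2 * (K n.+2 s * h s)).

Let quad_integrable a h : (forall i, (i <= 2)%N ->
    mu.-integrable D (EFin \o (fun s => K (n + i)%N s * h s))) ->
  mu.-integrable D (EFin \o quad a h) /\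
  \int[mu]_(s in D) quad a h s = \int[mu]_(s in D) (K n s * h s)
    - 2 * a * \int[mu]_(s in D) (K n.+1 s * h s)
    + a ^+ 2 * \int[mu]_(s in D) (K n.+2 s * h s).
Proof.
move=> Ih.
have I0 : mu.-integrable D (EFin \o (fun s => K n s * h s)).
  by have := Ih 0%N isT; rewrite addn0.
have I1 : mu.-integrable D (EFin \o (fun s => K n.+1 s * h s)).
  by have := Ih 1%N isT; rewrite addn1.
have I2 : mu.-integrable D (EFin \o (fun s => K n.+2 s * h s)).
  by have := Ih 2%N isT; rewrite addn2.
have J1 := integrableZl mD (- (2 * a)) I1.
have J2 := integrableZl mD (a ^+ 2) I2.
have J12 : mu.-integrable D (EFin \o
   (fun s => - (2 * a) * (K n.+1 s * h s) + a ^+ 2 * (K n.+2 s * h s))).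
  exact: (integrableD mD J1 J2).
split; first exact: (integrableD mD I0 J12).
rewrite RintegralD// RintegralD//.
by rewrite !RintegralZl//; ring.
Qed.

(* The quadratic expression in [a] is the integral of [g] against [K n] times a
   polynomial with two positive roots. Replacing [g] by the exponential that
   agrees with it at these roots decreases the integral, and turns it into a
   square. *)
Let quad_ge0 a : 0 < a -> 0 <= p n - 2 * a * p n.+1 + a ^+ 2 * p n.+2.
Proof.
move=> a0.
(* With [y = a * lam * s], the polynomial is [y ^ 2 - 2 m y + m (m - 1)] up to the positive factor
   [1 / (m (m - 1))]; its roots are [m - sqrt m] and [m + sqrt m], positive since [m > 1]. *)
pose m : R := n.+2%:R; have m1 : 1 < m by rewrite /m ltr1n.
pose r := Num.sqrt m.
have r0 : 0 < r by rewrite sqrtr_gt0; lra.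
have rE : r ^+ 2 = m by rewrite sqr_sqrtr//; lra.
have rm : r < m by rewrite expr2 in rE; nra.
have al0 : 0 < a * lam by rewrite mulr_gt0.
pose s1 := (m - r) / (a * lam); pose s2 := (m + r) / (a * lam).
have s10 : 0 < s1 by rewrite divr_gt0//; lra.
have s12 : s1 < s2 by rewrite ltr_pM2r ?invr_gt0//; lra.
have [A [b [A0 b0 Eg]]] := exp_chord s10 s12.
have lb0 : 0 < lam + b by rewrite ltr_wpDr.
have lbN : lam + b != 0 by rewrite gt_eqF.
pose E s := A * expR (- (b * s)).
have KE k : (fun s => K k s * E s) =
    (fun s => A * (lam / (lam + b)) ^+ k * poisson_kernel (lam + b) k s).
  apply/funext => s; rewrite /E mulrCA poisson_kernel_expRN//; ring.
have IK k := integrable_poisson_kernel k lb0.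
have IE i : (i <= 2)%N -> mu.-integrable D (EFin \o (fun s => K (n + i)%N s * E s)).
  move=> _; rewrite KE.
  exact: (integrableZl mD (A * (lam / (lam + b)) ^+ (n + i)) (IK (n + i)%N)).
have pE k : \int[mu]_(s in D) (K k s * E s) = A * (lam / (lam + b)) ^+ k / (lam + b).
  by rewrite KE RintegralZl// Rintegral_poisson_kernel.
have [Qg Qge] := quad_integrable a Ig.
have [QE QEe] := quad_integrable a IE.
rewrite -Qge; apply: (@le_trans _ _ (\int[mu]_(s in D) quad a E s)).
  rewrite QEe !pE.
  set t := lam / (lam + b).
  have -> : A * t ^+ n / (lam + b) - 2 * a * (A * t ^+ n.+1 / (lam + b)) +
     a ^+ 2 * (A * t ^+ n.+2 / (lam + b)) =
     A * t ^+ n / (lam + b) * (1 - a * t) ^+ 2 by rewrite !(exprS t); field.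
  have t0 : 0 < t by rewrite divr_gt0.
  by rewrite mulr_ge0 ?sqr_ge0// divr_ge0 ?ltW// mulr_gt0// exprn_gt0.
apply: le_Rintegral => // s /D0 s0.
have qE h : quad a h s = K n s * ((a * lam) ^+ 2 / (n.+1%:R * n.+2%:R)) *
    ((s - s1) * (s - s2)) * h s.
  have q1 : (s - s1) * (s - s2) =
      ((a * lam * s - m) ^+ 2 - m) / (a * lam) ^+ 2.
    by rewrite -{2}rE /s1 /s2; field; rewrite gt_eqF//= gt_eqF.
  rewrite q1 /quad /K /poisson_kernel !factS !natrM -/m !exprS.
  field; rewrite !pnatr_eq0 -lt0n fact_gt0/= ?(gt_eqF al0) ?(gt_eqF a0) ?(gt_eqF lam0)//.
  by rewrite -(natrD R 2 n) -(natrD R 1 n) !pnatr_eq0.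
rewrite -subr_ge0 !qE -mulrBr -(mulrA (K n s * _)) mulr_ge0//; last first.
  by rewrite mulrC; exact: Eg.
apply: mulr_ge0; first by apply: poisson_kernel_ge0; exact: ltW.
by apply: divr_ge0; [exact: sqr_ge0|exact: mulr_ge0].
Qed.

Lemma poisson_transform_log_convex : p n.+1 ^+ 2 <= p n * p n.+2.
Proof.
have p1 : 0 < p n.+1.
  by apply: poisson_transform_gt0; have := Ig (isT : (1 <= 2)%N); rewrite addn1.
have p2 : 0 < p n.+2.
  by apply: poisson_transform_gt0; have := Ig (isT : (2 <= 2)%N); rewrite addn2.
(* This value of [a] minimizes the quadratic expression. *)
have := quad_ge0 (divr_gt0 p1 p2).
have -> : p n - 2 * (p n.+1 / p n.+2) * p n.+1 + (p n.+1 / p n.+2) ^+ 2 * p n.+2 =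
  (p n * p n.+2 - p n.+1 ^+ 2) / p n.+2 by field; rewrite gt_eqF.
by rewrite pmulr_lge0 ?invr_gt0// subr_ge0.
Qed.

End poisson_transform_log_convex.

(** * Inversion of the Poisson transform *)

Section poisson_inversion.
Variable R : realType.
Implicit Types (s x y e d lam : R) (n : nat).

Local Notation mu := (@lebesgue_measure R).
Local Notation D := (`]0, +oo[%classic : set R).

Let mD : measurable (D : set (measurableTypeR R)). Proof. exact: measurable_itv. Qed.

Let D0 s : D s -> 0 < s. Proof. by rewrite /= in_itv/= andbT. Qed.

Lemma poisson_kernel_mull lam n s : lam != 0 ->
  poisson_kernel lam n s * s = n.+1%:R / lam * poisson_kernel lam n.+1 s.
Proof.
move=> l0; rewrite /poisson_kernel factS natrM exprS; field.
by rewrite l0 -(natrD R 1 n) !pnatr_eq0 -lt0n fact_gt0.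
Qed.

(** The weight [expR s] accommodates the growth of [W]. It lowers the rate to [m = lam - 1], and [t]
    and [t / m] are the mean and the variance of the Gamma law with parameters [n.+1] and [m]. The
    change of rate costs the factor [(lam / m) ^ n.+1], at most [expR t] because
    [lam / m = 1 + 1 / m]. *)
Lemma poisson_kernel_second_moment lam n x (m := lam - 1) (t := n.+1%:R / m) :
  1 < lam -> let f s := poisson_kernel lam n s * ((s - x) ^+ 2 * expR s) in
  mu.-integrable D (EFin \o f) /\
  lam * \int[mu]_(s in D) f s <= expR t * ((t - x) ^+ 2 + t / m).
Proof.
move=> lam1 f; have m0 : 0 < m by rewrite subr_gt0.
have mN : m != 0 by rewrite gt_eqF.
have lam0 : 0 < lam by lra.
pose c2 := (lam / m) ^+ n * (t * (n.+2%:R / m)).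
pose c1 := (lam / m) ^+ n * (- (2 * x) * t).
pose c0 := (lam / m) ^+ n * x ^+ 2.
have fE : f = fun s => c0 * poisson_kernel m n s +
    (c1 * poisson_kernel m n.+1 s + c2 * poisson_kernel m n.+2 s).
  apply/funext => s; rewrite /f.
  have E0 : poisson_kernel lam n s * expR s = (lam / m) ^+ n * poisson_kernel m n s.
    by have := @poisson_kernel_expRN _ lam (-1) n s mN; rewrite mulN1r opprK.
  have E1 := poisson_kernel_mull n s mN.
  have E2 := poisson_kernel_mull n.+1 s mN.
  have -> : poisson_kernel lam n s * ((s - x) ^+ 2 * expR s) =
    (poisson_kernel lam n s * expR s) * (s - x) ^+ 2 by ring.
  rewrite E0.
  have -> : (lam / m) ^+ n * poisson_kernel m n s * (s - x) ^+ 2 =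
    (lam / m) ^+ n * ((poisson_kernel m n s * s) * s -
      2 * x * (poisson_kernel m n s * s) + x ^+ 2 * poisson_kernel m n s) by ring.
  rewrite E1.
  have -> : n.+1%:R / m * poisson_kernel m n.+1 s * s =
    n.+1%:R / m * (poisson_kernel m n.+1 s * s) by ring.
  by rewrite E2 /c0 /c1 /c2 /t; ring.
have I k : mu.-integrable D (EFin \o poisson_kernel m k).
  exact: integrable_poisson_kernel.
have J0 := integrableZl mD c0 (I n).
have J1 := integrableZl mD c1 (I n.+1).
have J2 := integrableZl mD c2 (I n.+2).
have J12 : mu.-integrable D (EFin \o
    (fun s => c1 * poisson_kernel m n.+1 s + c2 * poisson_kernel m n.+2 s)).
  exact: (integrableD mD J1 J2).
split; first by rewrite fE; exact: (integrableD mD J0 J12).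
rewrite fE RintegralD// RintegralD// !RintegralZl// !Rintegral_poisson_kernel//.
have -> : lam * (c0 * m^-1 + (c1 * m^-1 + c2 * m^-1)) =
    (lam / m) ^+ n.+1 * ((t - x) ^+ 2 + t / m).
  rewrite /c0 /c1 /c2 (exprS (lam / m)) /t -(natr1 n.+1); field.
  exact: mN.
have t0 : 0 <= t by rewrite divr_ge0// ltW.
rewrite ler_wpM2r//.
  by rewrite addr_ge0 ?sqr_ge0// divr_ge0// ltW.
have -> : lam / m = 1 + m^-1.
  by apply: (mulIf mN); rewrite divfK// mulrDl mulVf// /m; ring.
have -> : t = m^-1 * n.+1%:R by rewrite mulrC.
rewrite expRM_natr lerXn2r ?nnegrE ?expR_ge0 ?expR_ge1Dx//.
by rewrite addr_ge0// invr_ge0 ltW.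
Qed.

Variables (W : R -> R) (C : R).
Hypothesis W_ge0 : forall s, 0 <= s -> 0 <= W s.
Hypothesis W_exp : forall s, 0 < s -> W s <= C * expR s.
Hypothesis IW : forall lam n, 1 < lam ->
  mu.-integrable D (EFin \o (fun s => poisson_kernel lam n s * W s)).

(* Chebyshev's inequality: [lam * poisson_kernel lam n] is the density of a
   Gamma law of mean [n.+1 / lam] and variance [n.+1 / lam ^+ 2]. *)
Lemma poisson_inversion x (n : nat -> nat) : 0 <= x ->
  (forall e, 0 < e -> exists2 d, 0 < d &
    forall y, 0 < y -> `|y - x| < d -> `|W y - W x| <= e) ->
  (fun k => (n k)%:R / k.+2%:R) @ \oo --> x ->
  (fun k => k.+2%:R * \int[mu]_(s in D) (poisson_kernel k.+2%:R (n k) s * W s))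
    @ \oo --> W x.
Proof.
move=> x0 Wc nx; apply/cvgrPdist_le => e e0.
have [d d0 Wd] := Wc (e / 2) ltac:(lra).
(* For [|y - x| >= d] the difference of values is at most [(C + W x) expR y], hence at most
   [M (y - x) ^ 2 expR y]. *)
pose M := (C + W x) / d ^+ 2.
have d20 : 0 < d ^+ 2 by rewrite exprn_gt0.
have C0 : 0 <= C.
  have := le_trans (W_ge0 (ler01 : 0 <= 1 :> R)) (W_exp ltr01).
  by rewrite pmulr_lge0// expR_gt0.
have M0 : 0 <= M by rewrite divr_ge0 ?(ltW d20)// addr_ge0// W_ge0.
have Wle y : 0 < y -> `|W y - W x| <= e / 2 + M * ((y - x) ^+ 2 * expR y).
  move=> y0; have [yd|yd] := ltP `|y - x| d.
    rewrite (le_trans (Wd y y0 yd))// lerDl mulr_ge0// mulr_ge0 ?expR_ge0//.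
    exact: sqr_ge0.
  apply: (@le_trans _ _ (M * ((y - x) ^+ 2 * expR y))); last by rewrite lerDr; lra.
  apply: (@le_trans _ _ ((C + W x) * expR y)).
    rewrite (le_trans (ler_normB _ _))// !ger0_norm ?W_ge0 ?(ltW y0)// mulrDl.
    by rewrite lerD ?W_exp// ler_peMr ?W_ge0//; have := expR_ge1Dx y; lra.
  rewrite mulrA ler_wpM2r ?expR_ge0// /M mulrAC ler_pdivlMr// ler_wpM2l//.
    by rewrite addr_ge0// W_ge0.
  by rewrite -(real_normK (num_real (y - x))) lerXn2r ?nnegrE ?normr_ge0// ltW.
pose t k := (n k).+1%:R / (k.+2%:R - 1) : R.
pose B k := expR (t k) * ((t k - x) ^+ 2 + t k / (k.+2%:R - 1)).
have main k : `|W x - k.+2%:R * \int[mu]_(s in D) (poisson_kernel k.+2%:R (n k) s * W s)|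
    <= e / 2 + M * B k.
  set lam : R := k.+2%:R; set K := poisson_kernel lam (n k).
  have lam1 : 1 < lam by rewrite /lam ltr1n.
  have lam0 : 0 < lam by lra.
  have IK : mu.-integrable D (EFin \o K) by exact: integrable_poisson_kernel.
  have [I2 B2] := poisson_kernel_second_moment (n k) x lam1.
  have JW := IW (n k) lam1.
  have JK := integrableZl mD (W x) IK.
  have JB : mu.-integrable D (EFin \o (fun s => K s * W s - W x * K s)).
    exact: (integrableB mD JW JK).
  have -> : W x - lam * \int[mu]_(s in D) (K s * W s) =
      - (lam * \int[mu]_(s in D) (K s * W s - W x * K s)).
    rewrite RintegralB// RintegralZl// Rintegral_poisson_kernel//; field.
    by rewrite gt_eqF.
  rewrite normrN normrM (gtr0_norm lam0).
  have JE := integrableZl mD (e / 2) IK.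
  have JM := integrableZl mD M I2.
  apply: (@le_trans _ _ (lam * \int[mu]_(s in D) (e / 2 * K s +
      M * (K s * ((s - x) ^+ 2 * expR s))))).
    rewrite ler_pM2l//; apply: (le_trans (le_normr_Rintegral mD JB)).
    apply: le_Rintegral => //.
    - exact: (integrable_norm JB).
    - exact: (integrableD mD JE JM).
    move=> s /D0 s0; have K0 : 0 <= K s by rewrite poisson_kernel_ge0// ltW.
    have -> : K s * W s - W x * K s = K s * (W s - W x) by ring.
    rewrite normrM (ger0_norm K0).
    apply: (le_trans (ler_wpM2l K0 (Wle s s0))).
    by rewrite le_eqVlt; apply/orP; left; apply/eqP; ring.
  rewrite RintegralD// !RintegralZl// Rintegral_poisson_kernel//.
  rewrite mulrDr (mulrCA lam) divff ?gt_eqF// mulr1 lerD2l mulrCA.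
  exact: ler_wpM2l.
have kB : (fun k => (k.+2%:R - 1)^-1 : R) @ \oo --> (0 : R).
  rewrite (_ : (fun k => _) = @harmonic R); first exact: cvg_harmonic.
  by apply/funext => k; rewrite /harmonic /= -natr1 addrK.
have tx : t @ \oo --> x.
  rewrite (_ : t = fun k => (n k)%:R / k.+2%:R * (1 + (k.+2%:R - 1)^-1)
     + (k.+2%:R - 1)^-1).
    rewrite -[X in _ --> X]addr0 -[X in _ --> X + 0]mulr1.
    apply: cvgD => //; apply: cvgM => //.
    by rewrite -[X in _ --> X]addr0; apply: cvgD => //; exact: cvg_cst.
  apply/funext => k; rewrite /t -(natr1 (n k)) -(natr1 k.+1); field.
  have k0 : 0 <= k%:R :> R by []; apply/andP; split; apply: lt0r_neq0; lra.
have cvB : (fun k => e / 2 + M * B k) @ \oo --> e / 2 + M * (expR x * ((x - x) ^+ 2 + x * 0)).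
  apply: cvgD; first exact: cvg_cst.
  apply: cvgMl_tmp; apply: cvgM.
    by apply: (cvg_comp _ _ tx); exact: continuous_expR.
  apply: cvgD; last exact: cvgM.
  have H : (fun k => t k - x) @ \oo --> x - x by apply: cvgB => //; exact: cvg_cst.
  by under eq_fun do rewrite expr2; rewrite expr2; exact: cvgM.
rewrite subrr expr0n/= mulr0 addr0 !mulr0 addr0 in cvB.
near=> k; apply: (le_trans (main k)); apply/ltW.
by near: k; apply: (cvgr_lt (e / 2)) => //; lra.
Unshelve. all: by end_near. Qed.

End poisson_inversion.

(** * Regularity of the scale function *)

Section scale_function_regularity.
Variable R : realType.
Implicit Types (s t x y z lam h p q r e : R) (n : nat).

Local Notation mu := (@lebesgue_measure R).
Local Notation D := (`]0, +oo[%classic : set R).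

Let mD : measurable (D : set (measurableTypeR R)). Proof. exact: measurable_itv. Qed.

Let D0 s : D s -> 0 < s. Proof. by rewrite /= in_itv/= andbT. Qed.

Variables (psi g W : R -> R) (delta : R).
Hypothesis delta_ge0 : 0 <= delta.
Hypothesis mg : measurable_fun D g.
Hypothesis g_gt0 : forall s, 0 < s -> 0 < g s.
Hypothesis g_noninc : forall s t, 0 < s -> s <= t -> g t <= g s.
Hypothesis g_log_convex : three_point_convex (fun s => ln (g s)).
Hypothesis psi_gt0 : forall t, 0 < t -> 0 < psi t.
Hypothesis psi_incr : forall t lam, 0 < t -> t < lam ->
  (\int[mu]_(s in D) ((expR (- (t * s)) - expR (- (lam * s))) * g s)%:E =
   (psi lam / lam - delta * (lam - t) - psi t / t)%:E)%E.
Hypothesis mW : measurable_fun D W.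
Hypothesis W_ge0 : forall s, 0 <= s -> 0 <= W s.
Hypothesis W_nondec : forall s t, 0 <= s -> s <= t -> W s <= W t.
Hypothesis W_cont : forall x, 0 <= x -> forall e, 0 < e -> exists2 d, 0 < d &
  forall y, 0 < y -> `|y - x| < d -> `|W y - W x| <= e.
Hypothesis W_laplace : forall t, 0 < t ->
  (\int[mu]_(s in D) (expR (- (t * s)) * W s)%:E = ((psi t)^-1)%:E)%E.

(** * The renewal equation at a fixed rate *)

Section discretization.
Variable lam : R.
Hypothesis lam0 : 0 < lam.

Let K := poisson_kernel lam.
(** The kernel index starts at 1, because [K 0 s * g s] need not be integrable near 0 when the jumps
    have unbounded variation. The generating function [H] below accordingly lacks the term of index
    0 and is divided by [z]. *)
Let P n := \int[mu]_(s in D) (K n.+1 s * g s).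
Let a n := if n == 0%N then delta * lam + P 0%N else P n.
Let c := psi lam / lam.
Let u n := lam * \int[mu]_(s in D) (K n s * W s).
Let w n := if n is m.+1 then u n - u m else u 0%N.

Let F n s := K n.+1 s * g s.

Let mF n : measurable_fun D (F n).
Proof. by apply: measurable_funM => //; exact: measurable_poisson_kernel. Qed.

Let F_ge0 n s : D s -> 0 <= F n s.
Proof.
by move=> /D0 s0; rewrite mulr_ge0 ?(ltW (g_gt0 _))// poisson_kernel_ge0 ?(ltW s0)// ltW.
Qed.

Let H z s := z^-1 * ((expR (- (lam * (1 - z) * s)) - expR (- (lam * s))) * g s).

Let FH z : z != 0 -> forall s, D s -> pseries (fun n => F n s) z @ \oo --> H z s.
Proof.
move=> z0 s Ds; have := @pseries_poisson_kernel R lam s z.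
rewrite -(cvg_shiftS (pseries _ z)) /= => cv.
rewrite (_ : pseries _ z = fun N => z^-1 *
   ((pseries (fun n => K n s) z N.+1 - expR (- (lam * s))) * g s)).
  apply: cvgMl_tmp; apply: cvgMr_tmp; apply: cvgB; first exact: cv.
  exact: cvg_cst.
apply/funext => N; rewrite /pseries /series /= !big_mkord big_ord_recl /=.
rewrite /K /poisson_kernel !expr0 fact0 divr1 !mulr1 addrAC subrr add0r.
rewrite mulr_suml mulr_sumr; apply: eq_bigr => i _; rewrite /F /K /poisson_kernel.
by rewrite /bump /= add1n [z ^+ i.+1]exprS; field; rewrite z0 pnatr_eq0 -lt0n fact_gt0.
Qed.

Let HI z : 0 < z -> z < 1 -> (\int[mu]_(s in D) (H z s)%:E =
  (z^-1 * (c - delta * lam * z - psi (lam * (1 - z)) / (lam * (1 - z))))%:E)%E.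
Proof.
move=> z0 z1.
have t0 : 0 < lam * (1 - z) by rewrite mulr_gt0// subr_gt0.
have t1 : lam * (1 - z) < lam by rewrite gtr_pMr//; lra.
under eq_integral do rewrite EFinM.
rewrite ge0_integralZl ?lee_fin ?invr_ge0 ?(ltW z0)//.
- rewrite psi_incr// -EFinM; congr (_ * _)%:E; rewrite /c; congr (_ - _ - _).
  by ring.
- apply/measurable_EFinP; apply: measurable_funM => //.
  by apply: measurable_funB; exact: measurable_expRN.
- move=> s /D0 s0; rewrite lee_fin mulr_ge0 ?(ltW (g_gt0 _))// subr_ge0.
  by rewrite ler_expR lerN2 ler_pM2r// ltW.
Qed.

Let IP n : mu.-integrable D (EFin \o (fun s => K n.+1 s * g s)).
Proof.
have h0 : 0 < 2^-1 :> R by rewrite invr_gt0.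
have h1 : 2^-1 < 1 :> R by rewrite invf_lt1// ltr1n.
have := @integral_coeff_lty _ _ R mu D mD F _ _ mF F_ge0 h0 (FH (lt0r_neq0 h0)).
rewrite HI// ltry => /(_ isT n) In.
by apply: ge0_integrable => //; [exact: (mF n)|move=> s; exact: (@F_ge0 n)].
Qed.

Let P_gt0 n : 0 < P n. Proof. exact: poisson_transform_gt0. Qed.

Let a_gt0 n : 0 < a n.
Proof.
rewrite /a; case: ifP => _; last exact: P_gt0.
by rewrite ltr_wpDl ?P_gt0// mulr_ge0// ltW.
Qed.

(** The drift raises [a 0] only, which occurs on the right side of the inequality for [n = 0] and
    nowhere else. *)
Let a_log_convex n : a n.+1 ^+ 2 <= a n * a n.+2.
Proof.
rewrite /a /=.
have Pn : P n.+1 ^+ 2 <= P n * P n.+2.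
  apply: (@poisson_transform_log_convex R lam g lam0 g_gt0 g_noninc g_log_convex n.+1).
  by move=> i _; exact: (IP (n + i)).
case: ifP => [/eqP n0|_]; last exact: Pn.
rewrite (le_trans Pn)// n0 ler_pM2r// lerDr mulr_ge0//; exact: ltW.
Qed.

(** Equivalently [z * A z = c - psi t / t] with [t = lam * (1 - z)]. As [u] has generating function
    [lam / psi t], this is the identity required by [renewal_equation]. *)
Let A z := delta * lam + z^-1 * (c - delta * lam * z - psi (lam * (1 - z)) / (lam * (1 - z))).

Let pseries_a z : 0 < z -> z < 1 -> pseries a z @ \oo --> A z.
Proof.
move=> z0 z1; rewrite -(cvg_shiftS (pseries a z)).
have := @pseries_integral _ _ R mu D mD F _ _ mF F_ge0 z0 (FH (lt0r_neq0 z0)).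
rewrite HI// ltry {2}/Rintegral HI//= => /(_ isT).
rewrite -(cvg_shiftS (pseries _ z)) => cv.
rewrite (_ : (fun N => pseries a z N.+1) =
    fun N => delta * lam + pseries P z N.+1).
  by apply: cvgD; [exact: cvg_cst|exact: cv].
apply/funext => N; rewrite /pseries /series /= !big_mkord !big_ord_recl /=.
by rewrite /a /= !expr0 !mulr1 addrA.
Qed.

Let W0' s : D s -> 0 <= W s. Proof. by move=> /D0 /ltW; exact: W_ge0. Qed.

Let WL t : 0 < t -> (\int[mu]_(s in D) (expR (- (t * s)) * W s)%:E < +oo)%E.
Proof. by move=> t0; rewrite W_laplace// ltry. Qed.

Lemma scale_transform_integrable n :
  mu.-integrable D (EFin \o (fun s => poisson_kernel lam n s * W s)).
Proof. exact: poisson_transform_integrable. Qed.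

Let u_ge0 n : 0 <= u n.
Proof.
rewrite mulr_ge0 ?(ltW lam0)//; apply: Rintegral_ge0 => s Ds.
by rewrite mulr_ge0 ?W0'// poisson_kernel_ge0 ?ltW// D0.
Qed.

Let pseries_u z : 0 < z -> z < 1 ->
  pseries u z @ \oo --> lam * (psi (lam * (1 - z)))^-1.
Proof.
move=> z0 z1; have := pseries_poisson_transform lam0 mW W0' WL z0 z1.
rewrite {2}/Rintegral W_laplace/= ?mulr_gt0 ?subr_gt0// => cv.
rewrite (_ : pseries u z = fun N => lam *
    pseries (fun n => \int[mu]_(s in D) (K n s * W s)) z N).
  by apply: cvgMl_tmp; exact: cv.
apply/funext => N; rewrite /pseries /series /= mulr_sumr.
by apply: eq_bigr => i _; rewrite /u mulrA.
Qed.

Let uE n : c * u n = 1 + \sum_(i < n) a i * u (n.-1 - i)%N.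
Proof.
apply: renewal_equation pseries_a pseries_u _ n => //; first by move=> k; exact: ltW.
move=> z z0 z1; rewrite /A.
have N1 : 1 - z != 0 by rewrite gt_eqF// subr_gt0.
have p0 : psi (lam * (1 - z)) != 0 by rewrite gt_eqF// psi_gt0// mulr_gt0// subr_gt0.
by field; rewrite p0 N1 !gt_eqF.
Qed.

Let w0E : c * w 0%N = 1.
Proof. by rewrite /w uE big_ord0 addr0. Qed.

Let wSE n : c * w n.+1 = \sum_(i < n.+1) a i * w (n - i)%N.
Proof.
rewrite /= mulrBr !uE big_ord_recr [RHS]big_ord_recr /= subnn.
have -> : \sum_(i < n) a i * w (n - i)%N =
    \sum_(i < n) a i * u (n - i)%N - \sum_(i < n) a i * u (n.-1 - i)%N.
  rewrite -sumrB; apply: eq_bigr => i _.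
  have -> : (n - i)%N = (n.-1 - i).+1 by have := ltn_ord i; lia.
  by rewrite /= mulrBr.
by rewrite /=; ring.
Qed.

Let sum_w n : \sum_(i < n.+1) w i = u n.
Proof.
elim: n => [|n IH]; first by rewrite big_ord1.
by rewrite big_ord_recr /= IH addrC subrK.
Qed.

Let c_gt0 : 0 < c. Proof. by rewrite divr_gt0// psi_gt0. Qed.

(** For [z < 1] the sum, times [z ^ n], is at most [z * A z], which is [c] minus the nonnegative
    [psi t / t] at [t = lam * (1 - z)]; then [z] tends to 1. *)
Let a_sum n : \sum_(i < n) a i <= c.
Proof.
have key z : 0 < z -> z < 1 -> z ^+ n * (\sum_(i < n) a i) <= c.
  move=> z0 z1; apply: (@le_trans _ _ (z * pseries a z n)).
    rewrite /pseries /series /= big_mkord !mulr_sumr; apply: ler_sum => i _.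
    rewrite mulrCA -exprS mulrC ler_pM2l//.
    by rewrite ler_wiXn2l// ltW.
  apply: (@le_trans _ _ (z * A z)).
    rewrite ler_pM2l// -(cvg_lim _ (pseries_a z0 z1))//.
    apply: nondecreasing_cvgn_le; last by apply/cvgP; exact: pseries_a.
    apply/nondecreasing_seqP => m; rewrite /pseries seriesSr lerDl.
    by rewrite mulr_ge0 ?exprn_ge0// ltW.
  have N1 : 1 - z != 0 by rewrite gt_eqF// subr_gt0.
  have -> : z * A z = c - psi (lam * (1 - z)) / (lam * (1 - z)).
    by rewrite /A; field; rewrite N1 !gt_eqF.
  rewrite gerBl divr_ge0// ltW ?psi_gt0// mulr_gt0// subr_gt0//.
have cl : (fun z => z ^+ n * (\sum_(i < n) a i)) @ 1^'- --> 1 ^+ n * (\sum_(i < n) a i).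
  apply: cvgMr_tmp; apply: cvg_at_left_filter; exact: exprn_continuous.
have cc : (fun=> c) @ (1 : R)^'- --> c by exact: cvg_cst.
have := ler_cvg_to cl cc; rewrite expr1n mul1r; apply.
near=> z; apply: key; last by near: z; exact: nbhs_left_lt.
by near: z; apply: nbhs_left_gt; exact: ltr01.
Unshelve. all: by end_near. Qed.

Lemma scale_renewal_structure : exists (c : R) (a w : nat -> R),
  [/\ 0 < c, forall n, 0 < a n, forall n, a n.+1 ^+ 2 <= a n * a n.+2 &
      c * w 0%N = 1] /\
  [/\ forall n, c * w n.+1 = \sum_(i < n.+1) a i * w (n - i)%N,
      forall n, \sum_(i < n) a i <= c,
      lam * delta <= c &
      forall n, lam * \int[mu]_(s in D) (poisson_kernel lam n s * W s) =
        \sum_(i < n.+1) w i].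
Proof.
exists c, a, w; split; split => //; last by move=> n; rewrite sum_w.
(* Already [a 0] contains [delta * lam]. *)
apply: le_trans (a_sum 1); rewrite big_ord1 /a /= mulrC lerDl; exact: ltW.
Qed.

End discretization.

(** The rates start at 2 because the inversion needs [lam > 1] to absorb the exponential growth of
    [W]. *)
Let rate k : R := k.+2%:R.
Let rate_gt0 k : 0 < rate k. Proof. by rewrite ltr0n. Qed.

Let U k n := rate k * \int[mu]_(s in D) (poisson_kernel (rate k) n s * W s).

(** As [W] is nondecreasing, the interval from [s] to [s + 1] contributes at least
    [expR (- (s + 1)) * W s] to the Laplace transform at 1. *)
Let W_exp : exists C, forall s, 0 < s -> W s <= C * expR s.
Proof.
exists (expR 1 / psi 1) => s s0; have p1 := psi_gt0 ltr01.
have : (\int[mu]_(y in `]s, (s + 1)%R[) (expR (- (s + 1)) * W s)%:E <= ((psi 1)^-1)%:E)%E.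
  rewrite -W_laplace//.
  apply: (@le_trans _ _ (\int[mu]_(y in `]s, (s + 1)%R[) (expR (- (1 * y)) * W y)%:E)%E).
    apply: ge0_le_integral => //=.
    - by move=> y _; rewrite lee_fin mulr_ge0 ?expR_ge0// W_ge0// ltW.
    - apply/measurable_EFinP; apply: measurable_funM.
        exact: measurable_expRN.
      apply: (measurable_funS mD _ mW).
      by move=> y /=; rewrite !in_itv/= andbT => /andP[sy _]; exact: lt_trans s0 sy.
    - move=> y; rewrite in_itv/= => /andP[sy ys]; rewrite lee_fin mul1r.
      apply: ler_pM; rewrite ?expR_ge0 ?W_ge0 ?(ltW s0)//.
        by rewrite ler_expR lerN2 ltW.
      by rewrite W_nondec// ltW.
  apply: ge0_subset_integral => //=.
  - apply/measurable_EFinP; apply: measurable_funM => //.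
    exact: measurable_expRN.
  - move=> y; rewrite in_itv/= andbT => y0.
    by rewrite lee_fin mulr_ge0 ?expR_ge0// W_ge0// ltW.
  - by move=> y /=; rewrite !in_itv/= andbT => /andP[sy _]; exact: lt_trans s0 sy.
rewrite integral_cst//= lebesgue_measure_itv/= lte_fin ltrDl ltr01.
rewrite -EFinD (addrC s) addrK mule1 lee_fin => H.
have := ler_wpM2l (expR_ge0 (1 + s)) H.
by rewrite mulrA -expRD subrr expR0 mul1r expRD; lra.
Qed.

Let limU x (n : nat -> nat) : 0 <= x ->
  (fun k => (n k)%:R / rate k) @ \oo --> x -> (fun k => U k (n k)) @ \oo --> W x.
Proof.
move=> x0 nx; have [C WC] := W_exp.
have IW lam m : 1 < lam ->
    mu.-integrable D (EFin \o (fun s => poisson_kernel lam m s * W s)).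
  by move=> lam1; apply: scale_transform_integrable; exact: lt_trans lam1.
exact: (@poisson_inversion R W C W_ge0 WC IW x n x0 (W_cont x0) nx).
Qed.

Let N x k := Num.truncn (x * rate k).

Let cvg_rateV : (fun k => (rate k)^-1) @ \oo --> (0 : R).
Proof.
have := @cvg_harmonic R; rewrite -(cvg_shiftS (@harmonic R)).
by [].
Qed.

Let cvgN x : 0 <= x -> (fun k => (N x k)%:R / rate k) @ \oo --> x.
Proof.
move=> x0; apply: (@squeeze_cvgr _ \oo _ _ (fun k => x - (rate k)^-1) (fun=> x)
  (fun k => (N x k)%:R / rate k)).
- near=> k; rewrite /N ler_pdivrMr// ler_pdivlMr// mulrBl mulVf ?gt_eqF//.
  have /andP[H1 H2] := truncn_itv (mulr_ge0 x0 (ltW (rate_gt0 k))).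
  by rewrite H1 andbT lerBlDr natr1 ltW.
- by rewrite -[X in _ --> X]subr0; apply: cvgB => //; exact: cvg_cst.
- exact: cvg_cst.
Unshelve. all: by end_near. Qed.

Let cvg_ratioD x y (n m : nat -> nat) :
  (fun k => (n k)%:R / rate k) @ \oo --> x ->
  (fun k => (m k)%:R / rate k) @ \oo --> y ->
  (fun k => (n k + m k)%:R / rate k) @ \oo --> x + y.
Proof. by move=> nx my; under eq_fun do rewrite natrD mulrDl; exact: cvgD. Qed.

Let cvg_ratioS x (n : nat -> nat) :
  (fun k => (n k)%:R / rate k) @ \oo --> x ->
  (fun k => (n k).+1%:R / rate k) @ \oo --> x.
Proof.
move=> nx; under eq_fun do rewrite -natr1 mulrDl mul1r.
by rewrite -[x]addr0; exact: cvgD.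
Qed.

Let U_concave k (n p q : nat) :
  q%:R * U k n + p%:R * U k (n + p + q)%N <= (p + q)%:R * U k (n + p)%N.
Proof.
have [c [a [w [[c0 a0 la w0] [wS asum _ uE]]]]] := scale_renewal_structure (rate_gt0 k).
have H := @convex_seq_three _ (fun n => - \sum_(i < n.+1) w i) n p q.
rewrite /U !uE -lerN2 opprD -!mulrN; apply: H => i.
rewrite [\sum_(_ < i.+3) _]big_ord_recr [\sum_(_ < i.+2) _]big_ord_recr /= mulr2n.
by have := renewal_nonincS c0 a0 la w0 wS asum i.+1; lra.
Qed.

Let U_convex_incr k (n m p q : nat) :
  (p + q)%:R * (U k (n + p + m)%N - U k (n + p)%N) <=
  q%:R * (U k (n + m)%N - U k n) + p%:R * (U k (n + p + q + m)%N - U k (n + p + q)%N).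
Proof.
have [c [a [w [[c0 a0 la w0] [wS asum _ uE]]]]] := scale_renewal_structure (rate_gt0 k).
by rewrite /U !uE; exact: renewal_sum_convex_incr c0 a0 la w0 wS _ _ _ _.
Qed.

Let U_second_diff k (n j m : nat) :
  (j * n.+1)%:R * (U k (n + j + m)%N *+ 2 - U k (n + j + m + m)%N - U k (n + j)%N)
  <= m%:R ^+ 2 * U k (n + j)%N.
Proof.
have [c [a [w [[c0 a0 la w0] [wS asum _ uE]]]]] := scale_renewal_structure (rate_gt0 k).
by rewrite /U !uE; exact: renewal_sum_second_diff c0 a0 la w0 wS asum _ _ _.
Qed.

Let U_linear k n : delta * U k n <= n.+1%:R / rate k.
Proof.
have [c [a [w [[c0 a0 la w0] [wS asum dc uE]]]]] := scale_renewal_structure (rate_gt0 k).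
rewrite ler_pdivlMr// /U uE.
apply: le_trans (renewal_sum_linear c0 a0 w0 wS asum n).
rewrite mulrAC ler_wpM2r//; last by rewrite mulrC.
by apply: sumr_ge0 => i _; exact/ltW/(renewal_gt0 c0 a0 w0 wS).
Qed.

Let U_third_diff k (j l m q : nat) (n := (j + l)%N) : 0 < delta ->
  l%:R / rate k * delta *
    ((U k (n + q + m.+1 + m.+1)%N - U k (n + m.+1 + m.+1)%N)
     - (U k (n + q + m.+1)%N - U k (n + m.+1)%N) *+ 2 + (U k (n + q)%N - U k n)) <=
  q%:R / rate k * (l%:R / rate k * (U k m *+ 2 - U k (m + m.+1)%N) / U k n
    + ((m.+1%:R / rate k) ^+ 2 *+ 2) * delta^-1 / U k j).
Proof.
move=> d0; have r0 := rate_gt0 k.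
(* The sign is needed to replace [c] by its lower bound [rate k * delta] in front of this factor. *)
have X0 : 0 <= (U k (n + q + m.+1 + m.+1)%N - U k (n + m.+1 + m.+1)%N)
     - (U k (n + q + m.+1)%N - U k (n + m.+1)%N) *+ 2 + (U k (n + q)%N - U k n).
  have H := U_convex_incr k n q m.+1 m.+1.
  rewrite -(pmulr_rge0 _ (_ : 0 < m.+1%:R)) ?ltr0n//.
  rewrite mulr2n; rewrite natrD in H.
  have E1 : (n + m.+1 + q)%N = (n + q + m.+1)%N by lia.
  have E2 : (n + m.+1 + m.+1 + q)%N = (n + q + m.+1 + m.+1)%N by lia.
  by rewrite E1 E2 in H; lra.
have [c [a [w [[c0 a0 la w0] [wS asum dc uE]]]]] := scale_renewal_structure r0.
have := renewal_sum_third_diff c0 a0 la w0 wS asum j l m q.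
have upos i : 0 < U k i.
  rewrite /U uE big_ord_recl ltr_wpDr ?(renewal_gt0 c0 a0 w0 wS)//.
  by apply: sumr_ge0 => l' _; exact/ltW/(renewal_gt0 c0 a0 w0 wS).
have uE' i : \sum_(j < i.+1) w j = U k i by rewrite /U uE.
rewrite /= -/n !uE' => H.
set X := (X in 0 <= X) in X0; rewrite -/X in H *.
set Y := (U k m *+ 2 - _) in H *.
apply: (@le_trans _ _ ((rate k)^-1 ^+ 2 * (l%:R * c * X))).
  have -> : (rate k)^-1 ^+ 2 * (l%:R * c * X) =
      l%:R / rate k * (c / rate k) * X by ring.
  rewrite ler_wpM2r// ler_wpM2l ?divr_ge0// ?ler0n ?(ltW r0)//.
  by rewrite ler_pdivlMr// mulrC.
apply: (le_trans (ler_wpM2l (exprn_ge0 2 (ltW (_ : 0 < (rate k)^-1))) H)).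
  by rewrite invr_gt0.
have -> : (rate k)^-1 ^+ 2 * (q%:R * (l%:R * Y / U k n + m.+1%:R ^+ 2 *+ 2 * w 0%N / U k j))
  = q%:R / rate k * (l%:R / rate k * Y / U k n
     + (m.+1%:R / rate k) ^+ 2 *+ 2 * (w 0%N * rate k) / U k j).
  by field; rewrite -(natrD R 2 k) pnatr_eq0 !gt_eqF.
apply: ler_wpM2l; first by rewrite divr_ge0// ltW.
rewrite lerD2l ler_wpM2r ?invr_ge0 ?(ltW (upos _))//.
apply: ler_wpM2l; first by rewrite mulrn_wge0// sqr_ge0.
(* [w 0 * rate k <= 1 / delta], from [c * w 0 = 1] and [rate k * delta <= c]. *)
by rewrite -(ler_pM2l c0) mulrA w0 mul1r ler_pdivlMr.
Qed.

(** * Finite difference inequalities for the scale function *)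

Let scale_concave x p q : 0 <= x -> 0 < p -> 0 < q ->
  q * W x + p * W (x + p + q) <= (p + q) * W (x + p).
Proof.
move=> x0 p0 q0.
have cx := cvgN x0; have cp := cvgN (ltW p0); have cq := cvgN (ltW q0).
have cxp := cvg_ratioD cx cp; have cxpq := cvg_ratioD cxp cq.
apply: (@ler_cvg_to _ \oo _ _
  (fun k => (N q k)%:R / rate k * U k (N x k) +
    (N p k)%:R / rate k * U k (N x k + N p k + N q k)%N)
  (fun k => (N p k + N q k)%:R / rate k * U k (N x k + N p k)%N)).
- apply: cvgD; apply: cvgM => //; apply: limU => //; lra.
- apply: cvgM; first exact: cvg_ratioD.
  by apply: limU => //; lra.
near=> k; have := U_concave k (N x k) (N p k) (N q k).
have r0 : 0 < (rate k)^-1 by rewrite invr_gt0.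
by rewrite -(ler_pM2l r0); move: ((rate k)^-1) (U k) => v u'; lra.
Unshelve. all: by end_near. Qed.

Let scale_convex_incr x h p q : 0 < x -> 0 < h -> 0 < p -> 0 < q ->
  (p + q) * (W (x + p + h) - W (x + p)) <=
  q * (W (x + h) - W x) + p * (W (x + p + q + h) - W (x + p + q)).
Proof.
move=> x0 h0 p0 q0; have cx := cvgN (ltW x0); have cp := cvgN (ltW p0).
have cq := cvgN (ltW q0); have ch := cvgN (ltW h0).
have cxp := cvg_ratioD cx cp; have cxpq := cvg_ratioD cxp cq.
apply: (@ler_cvg_to _ \oo _ _
  (fun k => (N p k + N q k)%:R / rate k *
    (U k (N x k + N p k + N h k)%N - U k (N x k + N p k)%N))
  (fun k => (N q k)%:R / rate k * (U k (N x k + N h k)%N - U k (N x k)) +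
    (N p k)%:R / rate k * (U k (N x k + N p k + N q k + N h k)%N
      - U k (N x k + N p k + N q k)%N))).
- apply: cvgM; first exact: cvg_ratioD.
  by apply: cvgB; apply: limU => //; [lra|exact: cvg_ratioD|lra].
- apply: cvgD; apply: cvgM => //; apply: cvgB; apply: limU => //;
    by [lra|exact: cvg_ratioD].
near=> k; have := U_convex_incr k (N x k) (N h k) (N p k) (N q k).
have r0 : 0 < (rate k)^-1 by rewrite invr_gt0.
by rewrite -(ler_pM2l r0); move: ((rate k)^-1) (U k) => v u'; lra.
Unshelve. all: by end_near. Qed.

Let scale_second_diff x y h : 0 < x -> 0 < y -> 0 < h ->
  y * x * (W (x + y + h) *+ 2 - W (x + y + h + h) - W (x + y)) <=
  h ^+ 2 * W (x + y).
Proof.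
move=> x0 y0 h0; have cx := cvgN (ltW x0); have cy := cvgN (ltW y0).
have ch := cvgN (ltW h0); have cxy := cvg_ratioD cx cy.
have cxyh := cvg_ratioD cxy ch.
apply: (@ler_cvg_to _ \oo _ _
  (fun k => (N y k)%:R / rate k * ((N x k).+1%:R / rate k) *
    (U k (N x k + N y k + N h k)%N *+ 2 - U k (N x k + N y k + N h k + N h k)%N
     - U k (N x k + N y k)%N))
  (fun k => ((N h k)%:R / rate k * ((N h k)%:R / rate k)) * U k (N x k + N y k)%N)).
- apply: cvgM; first by apply: cvgM => //; exact: cvg_ratioS.
  apply: cvgB; first apply: cvgB; first apply: cvgMn; apply: limU => //;
    by [lra|exact: cvg_ratioD].
- by rewrite expr2; apply: cvgM; [exact: cvgM|apply: limU => //; lra].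
near=> k; have := U_second_diff k (N x k) (N y k) (N h k).
have r0 : 0 < (rate k)^-1 by rewrite invr_gt0.
by rewrite -(ler_pM2l r0) -(ler_pM2l r0) natrM expr2;
  move: ((rate k)^-1) (U k) => v u'; lra.
Unshelve. all: by end_near. Qed.

Let scale_linear x : 0 <= x -> delta * W x <= x.
Proof.
move=> x0; have cx := cvgN x0.
apply: (@ler_cvg_to _ \oo _ _ (fun k => delta * U k (N x k))
  (fun k => (N x k).+1%:R / rate k)).
- by apply: cvgMl_tmp; exact: limU.
- exact: cvg_ratioS.
by near=> k.
Unshelve. all: by end_near. Qed.

(** A zero of [W] at [x > 0] would spread to the left by monotonicity and to the right by concavity,
    and the Laplace transform would vanish instead of being [1 / psi 1] at 1. *)
Let scale_gt0 x : 0 < x -> 0 < W x.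
Proof.
move=> x0; rewrite lt_neqAle W_ge0 ?(ltW x0)// andbT eq_sym; apply/eqP => Wx0.
have W0 y : 0 < y -> W y = 0.
  move=> y0; apply/eqP; rewrite eq_le W_ge0 ?(ltW y0)// andbT.
  have [yx|xy] := leP y x; first by rewrite -Wx0 W_nondec// ltW.
  have := @scale_concave 0 x (y - x) (lexx 0) x0 ltac:(lra).
  rewrite add0r subrKC Wx0 mulr0 => H.
  have := mulr_ge0 (_ : 0 <= y - x) (W_ge0 (lexx 0)); move=> /(_ ltac:(lra)) H0.
  by rewrite -(ler_pM2l x0) mulr0; lra.
have := W_laplace ltr01; rewrite integral0_eq.
  by move=> [] E; have := psi_gt0 ltr01; rewrite -invr_gt0 -E ltxx.
by move=> s /D0 s0; rewrite W0// mulr0.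
Qed.

Let scale_third_diff : 0 < delta -> forall y t h r, 0 < y -> 0 < t -> 0 < h -> 0 < r ->
  t * delta * ((W (y + t + r + h + h) - W (y + t + h + h))
               - (W (y + t + r + h) - W (y + t + h)) *+ 2
               + (W (y + t + r) - W (y + t))) <=
  r * (t * (W h *+ 2 - W (h + h)) / W (y + t) + h ^+ 2 *+ 2 * delta^-1 / W y).
Proof.
move=> d0 y t h r y0 t0 h0 r0; have cy := cvgN (ltW y0); have ct := cvgN (ltW t0).
have ch := cvgN (ltW h0); have cr := cvgN (ltW r0); have chS := cvg_ratioS ch.
have cyt := cvg_ratioD cy ct; have cytr := cvg_ratioD cyt cr.
have cyth := cvg_ratioD cyt chS; have cytrh := cvg_ratioD cytr chS.
apply: (@ler_cvg_to _ \oo _ _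
  (fun k => (N t k)%:R / rate k * delta *
    ((U k (N y k + N t k + N r k + (N h k).+1 + (N h k).+1)%N
       - U k (N y k + N t k + (N h k).+1 + (N h k).+1)%N)
     - (U k (N y k + N t k + N r k + (N h k).+1)%N
       - U k (N y k + N t k + (N h k).+1)%N) *+ 2
     + (U k (N y k + N t k + N r k)%N - U k (N y k + N t k)%N)))
  (fun k => (N r k)%:R / rate k *
    ((N t k)%:R / rate k * (U k (N h k) *+ 2 - U k (N h k + (N h k).+1)%N)
      / U k (N y k + N t k)%N
    + ((N h k).+1%:R / rate k * ((N h k).+1%:R / rate k)) *+ 2 * delta^-1
      / U k (N y k)))).
- apply: cvgM; first by apply: cvgM => //; exact: cvg_cst.
  apply: cvgD; last by apply: cvgB; apply: limU => //; lra.
  apply: cvgB; last by apply: cvgMn; apply: cvgB; apply: limU => //; lra.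
  by apply: cvgB; apply: limU; [lra|exact: cvg_ratioD|lra|exact: cvg_ratioD].
- apply: cvgM => //; apply: cvgD.
    apply: cvgM; last first.
      by apply: cvgV; [rewrite gt_eqF// scale_gt0//; lra|apply: limU => //; lra].
    apply: cvgM => //; apply: cvgB.
      by apply: cvgMn; apply: limU => //; lra.
    by apply: limU; [lra|exact: cvg_ratioD].
  apply: cvgM; last first.
    by apply: cvgV; [rewrite gt_eqF// scale_gt0|apply: limU => //; lra].
  apply: cvgM; last exact: cvg_cst.
  by rewrite expr2; apply: cvgMn; exact: cvgM.
near=> k; have := U_third_diff k (N y k) (N t k) (N h k) (N r k) d0.
by rewrite expr2.
Unshelve. all: by end_near. Qed.

Lemma scale_regularity :
  [/\ differentiable_on_pos W, convex_on `]0, +oo[ W^`()%classic &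
      0 < delta -> C2_on_pos W].
Proof.
split.
- exact: derivable_of_second_diff W_ge0 W_nondec scale_concave scale_second_diff.
- exact: convex_derive_of_convex_incr W_ge0 W_nondec scale_concave
    scale_second_diff scale_convex_incr.
move=> d0.
exact: (C2_of_third_diff W_ge0 W_nondec scale_concave scale_second_diff
  scale_convex_incr d0 scale_linear scale_gt0 (scale_third_diff d0)).
Qed.

End scale_function_regularity.

(** * Laplace exponents *)

Section tail_integral.
Variable R : realType.
Implicit Types (s t x y theta lam : R).

Local Notation mu := (@lebesgue_measure R).
Local Notation D := (`]0, +oo[%classic : set R).

Lemma tonelli_tail (Pi : {sigma_finite_measure set R -> \bar R}) (f : R -> R) :
  measurable_fun setT f -> (forall s, 0 < s -> 0 <= f s) ->
  (\int[mu]_(s in D) ((f s)%:E * Pi `]s, +oo[%classic) =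
   \int[Pi]_(x in D) \int[mu]_(s in `]0%R, x[) (f s)%:E)%E.
Proof.
move=> mf f0.
(* The region [0 < s < x] is encoded by indicators of [s] and of [x - s], whose measurability
   follows by composition. *)
pose F (p : measurableTypeR R * R) : \bar R :=
  (f p.1 * \1_(`]0, +oo[%classic : set R) p.1 * \1_(`]0, +oo[%classic : set R) (p.2 - p.1))%:E.
have m1 : measurable_fun setT (fun p : measurableTypeR R * R => p.1 : R).
  exact: measurable_fst.
have m2 : measurable_fun setT (fun p : measurableTypeR R * R => p.2 : R).
  exact: measurable_snd.
have mF : measurable_fun setT F.
  apply/measurable_EFinP; apply: measurable_funM; first apply: measurable_funM.
  - exact: (measurableT_comp mf m1).
  - by apply: (measurableT_comp _ m1); exact: measurable_indic.
  - apply: (measurableT_comp (measurable_indic _)); first exact: measurable_itv.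
    exact: measurable_funB.
have F0 p : (0 <= F p)%E.
  rewrite lee_fin mulr_ge0 ?indic_ge0// indicE.
  have [p1|p1] := boolP (p.1 \in _); last by rewrite mulr0.
  by rewrite mulr1 f0//; move: p1; rewrite inE/= in_itv/= andbT.
have := fubini_tonelli (m1 := mu) (m2 := Pi) F mF F0.
have -> : (\int[mu]_x \int[Pi]_y F (x, y) =
    \int[mu]_(s in D) ((f s)%:E * Pi `]s, +oo[%classic))%E.
  rewrite [RHS]integral_mkcond; apply: eq_integral => s _; rewrite patchE.
  case: ifPn => sD; last first.
    by apply: integral0_eq => y _; rewrite /F /= indicE (negbTE sD) mulr0 mul0r.
  have s0 : 0 < s by move: sD; rewrite inE/= in_itv/= andbT.
  have s1 : \1_(`]0, +oo[%classic : set R) s = 1 :> R by rewrite indicE sD.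
  under eq_integral do rewrite /F /= s1 mulr1 EFinM.
  rewrite ge0_integralZl ?lee_fin ?f0//; last first.
    apply/measurable_EFinP; apply: (measurableT_comp (measurable_indic _)).
      exact: measurable_itv.
    by apply: measurable_funB => //; exact: measurable_cst.
  congr (_ * _)%E; rewrite -(setIT `]s, +oo[%classic) -integral_indic//=.
  apply: eq_integral => y _; rewrite !indicE; congr (_%:E); congr (_%:R).
  by congr (nat_of_bool _); apply/idP/idP; rewrite !inE/= !in_itv/= !andbT subr_gt0.
move=> ->; rewrite [RHS]integral_mkcond; apply: eq_integral => x _; rewrite patchE.
case: ifPn => xD; last first.
  have x0 : x <= 0 by move: xD; rewrite notin_setE/= in_itv/= andbT => /negP; rewrite -leNgt.
  apply: integral0_eq => s _; rewrite /F /= !indicE.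
  have [|_] := boolP (s \in _); last by rewrite mulr0 mul0r.
  rewrite inE/= in_itv/= andbT => s0.
  have [|_] := boolP (x - s \in _); last by rewrite mulr0.
  by rewrite inE/= in_itv/= andbT subr_gt0 => /(lt_trans s0); rewrite ltNge x0.
rewrite [RHS]integral_mkcond; apply: eq_integral => s _; rewrite patchE /F /= !indicE.
have -> : (s \in `]0, x[%classic) = (s \in (`]0, +oo[%classic : set R)) &&
    (x - s \in (`]0, +oo[%classic : set R)).
  by rewrite !mem_setE !in_itv/= !andbT subr_gt0.
by case: (_ \in _); case: (_ \in _) => /=; rewrite ?mulr1 ?mulr0 ?mul0r.
Qed.

End tail_integral.

Section levy_exponent.
Variable R : realType.
Implicit Types (s t x y theta lam : R).

Local Notation mu := (@lebesgue_measure R).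
Local Notation D := (`]0, +oo[%classic : set R).

Let mD : measurable D. Proof. exact: measurable_itv. Qed.

Let D0 s : D s -> 0 < s. Proof. by rewrite /= in_itv/= andbT. Qed.

(** [expR (- x) <= 1 / (1 + x)], and [(1 + x) (1 - x + x ^ 2) = 1 + x ^ 3 >= 1]. *)
Lemma expRN_le_quadratic x : 0 <= x -> expR (- x) <= 1 - x + x ^+ 2.
Proof.
move=> x0; rewrite expRN; apply: (@le_trans _ _ (1 + x)^-1).
  by rewrite lef_pV2 ?posrE ?expR_gt0 ?expR_ge1Dx//; lra.
rewrite -(ler_pM2l (_ : 0 < 1 + x)) ?mulfV ?gt_eqF//; try lra.
have := exprn_ge0 3 x0; rewrite !exprS expr0; lra.
Qed.

Variable Pi : {measure set R -> \bar R}.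
Hypothesis Pi_levy : levy_measure Pi.

Lemma levy_min_integrable : Pi.-integrable D (EFin \o (fun x => Num.min 1 (x ^+ 2))).
Proof.
have [_ Pi_fin] := Pi_levy.
apply: ge0_integrable => //; last by move=> x _; rewrite le_min ler01 sqr_ge0.
apply: measurable_minr; first exact: measurable_cst.
exact: (measurable_funX 2 (@measurable_id _ _ D)).
Qed.

Lemma levy_tail_lty s : 0 < s -> (Pi `]s, +oo[%classic < +oo)%E.
Proof.
move=> s0; have [_ Pi_fin] := Pi_levy.
have m0 : 0 < Num.min 1 (s ^+ 2) by rewrite lt_min ltr01 exprn_gt0.
have mI := levy_min_integrable.
rewrite -(@lte_pmul2l _ (Num.min 1 (s ^+ 2))%:E)// mulry gtr0_sg// mul1e.
have ms : measurable (`]s, +oo[%classic : set R) by exact: measurable_itv.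
apply: le_lt_trans Pi_fin; rewrite -(integral_cst Pi ms).
have sub : `]s, +oo[ `<=` D.
  by move=> x /=; rewrite !in_itv/= !andbT; exact: lt_trans.
have mf : measurable_fun D (EFin \o (fun x => Num.min 1 (x ^+ 2))).
  exact: (measurable_int Pi mI).
apply: (@le_trans _ _ (\int[Pi]_(x in `]s, +oo[) (Num.min 1 (x ^+ 2))%:E)%E).
  apply: ge0_le_integral => //.
  - by move=> x _; rewrite lee_fin ltW.
  - exact: (measurable_funS mD sub mf).
  - move=> x; rewrite /= in_itv/= andbT => sx; rewrite lee_fin.
    rewrite le_min !ge_min lexx/=; apply/orP; right.
    by rewrite lerXn2r ?nnegrE ?(ltW s0) ?(ltW (lt_trans s0 sx))// ltW.
apply: ge0_subset_integral => //.
by move=> x _; rewrite lee_fin le_min ler01 sqr_ge0.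
Qed.

(** The tails from [1 / (n + 1)] have finite measure and exhaust the positive reals; the null set of
    nonpositive reals is adjoined to cover the line. *)
Lemma levy_sigma_finite : sigma_finite setT Pi.
Proof.
have [Pi0 _] := Pi_levy.
exists (fun n => `]-oo, 0%R] `|` `]n.+1%:R^-1, +oo[).
  apply/esym; rewrite -subTset => x _ /=.
  have [x0|x0] := leP x 0; first by exists 0%N => //; left; rewrite /= in_itv.
  exists (Num.truncn x^-1) => //; right; rewrite /= in_itv/= andbT.
  by rewrite invf_plt ?posrE ?ltr0n// truncnS_gt.
move=> n; split; first exact: measurableU.
apply: (le_lt_trans (measureU2 Pi (measurable_itv _) (measurable_itv _))) => //.
rewrite [X in (X + _)%E](_ : _ = 0%E); last exact: Pi0.
rewrite add0e; apply: levy_tail_lty.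
by rewrite invr_gt0 ltr0n.
Qed.

Let h theta x := 1 - expR (- (theta * x)) - theta * x * \1_`]0, 1[ x.

Let measurable_h theta : measurable_fun D (h theta).
Proof.
apply: measurable_funB.
  by apply: measurable_funB; [exact: measurable_cst|exact: measurable_expRN].
apply: measurable_funM; first by apply: measurable_funM => //; exact: measurable_cst.
by apply: measurable_indic; exact: measurable_itv.
Qed.

Lemma levy_integrand_le theta x : 0 <= theta -> 0 < x ->
  `|h theta x| <= (theta ^+ 2 + 1) * Num.min 1 (x ^+ 2).
Proof.
move=> t0 x0; rewrite /h indicE mem_setE in_itv/= x0/=.
have tx0 : 0 <= theta * x by rewrite mulr_ge0// ltW.
have e1 : expR (- (theta * x)) <= 1 by rewrite expR_le1 oppr_le0.
have e2 := expR_ge0 (- (theta * x)).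
have [x1|x1] := ltP x 1.
  have x21 : x ^+ 2 <= 1 by rewrite expr_le1 ?ltW.
  rewrite (min_idPr x21) mulr1.
  have := expR_ge1Dx (- (theta * x)); have := expRN_le_quadratic tx0.
  rewrite exprMn => H1 H2; rewrite ler_norml; have := sqr_ge0 x.
  by move=> x20; apply/andP; split; nra.
have x21 : 1 <= x ^+ 2 by rewrite exprn_ege1.
rewrite (min_idPl x21) !mulr0 subr0 mulr1 ger0_norm; have := sqr_ge0 theta; lra.
Qed.

Lemma levy_integrand_integrable theta : 0 <= theta ->
  Pi.-integrable D (EFin \o h theta).
Proof.
move=> t0; apply: (le_integrable mD _ _
  (integrableZl mD (theta ^+ 2 + 1) levy_min_integrable)).
- by apply/measurable_EFinP; exact: (measurable_h theta).
move=> x /D0 x0; rewrite /= lee_fin; apply: (le_trans (levy_integrand_le t0 x0)).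
exact: ler_norm.
Qed.

Variable dens : R -> R.
Hypothesis Pi_dens : positive_density Pi dens.

Lemma levy_tailE s : 0 < s -> Pi `]s, +oo[%classic = (tail dens s)%:E.
Proof.
move=> s0; have [_ _ PiE] := Pi_dens.
have E : Pi `]s, +oo[%classic = (\int[mu]_(x in `]s, +oo[) (dens x)%:E)%E.
  apply: PiE; first exact: measurable_itv.
  by move=> x /=; rewrite !in_itv/= !andbT; exact: lt_trans.
by rewrite /tail /Rintegral -E fineK// ge0_fin_numE// levy_tail_lty.
Qed.

Lemma tail_noninc s t : 0 < s -> s <= t -> tail dens t <= tail dens s.
Proof.
move=> s0 st; have t0 := lt_le_trans s0 st.
rewrite -lee_fin -!levy_tailE//; apply: le_measure; rewrite ?inE//=.
by move=> x /=; rewrite !in_itv/= !andbT; exact: le_lt_trans.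
Qed.

End levy_exponent.

Section levy_exponent_increment.
Variable R : realType.
Implicit Types (s t x y theta lam : R).

Local Notation mu := (@lebesgue_measure R).
Local Notation D := (`]0, +oo[%classic : set R).

Let mD : measurable D. Proof. exact: measurable_itv. Qed.

Let D0 s : D s -> 0 < s. Proof. by rewrite /= in_itv/= andbT. Qed.

Lemma integral_expRN_diff t lam x : 0 < t -> t < lam -> 0 < x ->
  (\int[mu]_(s in `]0%R, x[) (expR (- (t * s)) - expR (- (lam * s)))%:E =
   ((1 - expR (- (t * x))) / t - (1 - expR (- (lam * x))) / lam)%:E)%E.
Proof.
move=> t0 tl x0; have l0 : 0 < lam by lra.
pose f s := expR (- (t * s)) - expR (- (lam * s)).
pose F s := - t^-1 * expR (- (t * s)) - - lam^-1 * expR (- (lam * s)).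
have E a s : a != 0 -> is_derive s 1 (fun s => - a^-1 * expR (- (a * s))) (expR (- (a * s))).
  move=> a0.
  have H1 : is_derive s 1 (fun s : R => - (a * s)) (- a).
    have := is_deriveN (is_deriveZ a (is_derive_id s 1)).
    by rewrite /GRing.scale/= mulr1.
  have H2 := @is_derive1_comp R expR (fun s : R => - (a * s)) s _ _ (is_derive_expR _) H1.
  by apply: (is_derive_eq (is_deriveZ (- a^-1) H2)); rewrite /GRing.scale/=; field.
have dF s : is_derive s 1 F (f s).
  by apply: is_deriveB; apply: E; rewrite gt_eqF.
have cF s : {for s, continuous F}.
  by apply: differentiable_continuous; apply/derivable1_diffP; exact: (@ex_derive _ _ _ _ _ _ _ (dF s)).
have cf s : {for s, continuous f}.
  apply: cvgB; (apply: continuous_comp; last exact: continuous_expR);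
  by apply: cvgN; apply: cvgM; [exact: cvg_cst|exact: cvg_id].
have mf : measurable_fun `]0, x[ (EFin \o f).
  apply/measurable_EFinP; apply: measurable_funB; exact: measurable_expRN.
rewrite -(integral_itv_bndoo true false mf) (@continuous_FTC2 _ f F)//.
- rewrite -EFinB /F !mulr0 !oppr0 expR0; congr (_%:E); field.
  by rewrite !gt_eqF.
- exact: continuous_subspaceT.
- split.
  + by move=> s _; exact: (@ex_derive _ _ _ _ _ _ _ (dF s)).
  + by apply: cvg_at_right_filter; exact: cF.
  + by apply: cvg_at_left_filter; exact: cF.
- by move=> s _; rewrite derive1E; exact: (@derive_val _ _ _ _ _ _ _ (dF s)).
Qed.

Variables (gamma sigma : R) (Pi : {measure set R -> \bar R}) (dens : R -> R).
Hypothesis Pi_levy : levy_measure Pi.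
Hypothesis Pi_dens : positive_density Pi dens.

(** A copy of [Pi] to which the sigma-finite structure required by Tonelli's theorem can be
    attached. *)
Let sPi : set R -> \bar R := Pi.
HB.instance Definition _ := Measure.on sPi.
HB.instance Definition _ :=
  Measure_isSigmaFinite.Build _ _ _ sPi (levy_sigma_finite Pi_levy).

Let psi := laplace_exponent gamma sigma Pi.

Let h theta x := 1 - expR (- (theta * x)) - theta * x * \1_`]0, 1[ x.

(** In the increment of [psi t / t] the coefficient [gamma] and the compensator of small jumps
    cancel, and Tonelli's theorem turns the remaining integral over the jumps into one against the
    tail. The difference of exponentials vanishes at 0, where the tail alone may fail to be
    integrable. *)
Lemma laplace_exponent_incr t lam : 0 < t -> t < lam ->
  (\int[mu]_(s in D) ((expR (- (t * s)) - expR (- (lam * s))) * tail dens s)%:E =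
   (psi lam / lam - 2^-1 * sigma ^+ 2 * (lam - t) - psi t / t)%:E)%E.
Proof.
move=> t0 tl; have l0 : 0 < lam by lra.
pose Pi' : {sigma_finite_measure set R -> \bar R} := sPi.
pose f s := expR (- (t * s)) - expR (- (lam * s)).
have mf : measurable_fun setT f.
  by apply: measurable_funB; exact: measurable_expRN.
have f0 s : 0 < s -> 0 <= f s.
  by move=> s0; rewrite subr_ge0 ler_expR lerN2 ler_pM2r// ltW.
transitivity (\int[mu]_(s in D) ((f s)%:E * Pi' `]s, +oo[%classic))%E.
  apply: eq_integral => s /set_mem/D0 s0; rewrite EFinM; congr (_ * _)%E.
  exact/esym/(levy_tailE Pi_levy Pi_dens s0).
rewrite tonelli_tail//.
have It := levy_integrand_integrable Pi_levy (ltW t0).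
have Il := levy_integrand_integrable Pi_levy (ltW l0).
have Jt := integrableZl mD t^-1 It.
have Jl := integrableZl mD lam^-1 Il.
transitivity (\int[Pi]_(x in D) (t^-1 * h t x - lam^-1 * h lam x))%:E.
  rewrite EFin_Rintegral//; last exact: (integrableB mD Jt Jl).
  apply: eq_integral => x /set_mem/D0 x0.
  rewrite integral_expRN_diff//; congr (_%:E); rewrite /h; field.
  by rewrite !gt_eqF.
congr (_%:E); rewrite RintegralB// !RintegralZl//.
rewrite /psi /laplace_exponent; field.
by rewrite !gt_eqF.
Qed.

End levy_exponent_increment.

(** * Drift of the descending ladder height process *)

Section drift.
Variable R : realType.
Implicit Types (s t x y theta : R).

Local Notation D := (`]0, +oo[%classic : set R).

Let mD : measurable D. Proof. exact: measurable_itv. Qed.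

Let D0 s : D s -> 0 < s. Proof. by rewrite /= in_itv/= andbT. Qed.

Lemma dominated_Rintegral_cvg0 (m : {measure set R -> \bar R}) (f : nat -> R -> R)
    (g c : R -> R) : (forall n, measurable_fun D (f n)) ->
  m.-integrable D (EFin \o g) -> (forall n x, D x -> `|f n x| <= g x) ->
  (forall n x, D x -> `|f n x| <= c x * n.+1%:R^-1) ->
  (fun n => \int[m]_(x in D) f n x) @ \oo --> (0 : R).
Proof.
move=> mf gi fg fc.
have cf x : D x -> f ^~ x @ \oo --> (0 : R).
  move=> Dx; apply/cvgrPdist_le => e e0.
  have cvc : (fun n => c x * n.+1%:R^-1) @ \oo --> c x * 0.
    by apply: cvgMl_tmp; exact: cvg_harmonic.
  rewrite mulr0 in cvc; near=> n; rewrite sub0r normrN.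
  apply: (le_trans (fc n x Dx)); apply/ltW.
  by near: n; apply: (cvgr_lt 0).
have [] := @dominated_convergence _ _ R m D mD (fun n => EFin \o f n) (cst 0%E) (EFin \o g).
- by move=> n; apply/measurable_EFinP.
- exact: measurable_cst.
- by apply: aeW => x Dx; apply: cvg_EFin; [exact: nearW|exact: cf].
- exact: gi.
- by apply: aeW => x n Dx; rewrite /= lee_fin fg.
move=> _ _; rewrite integral0 => cv.
exact: (fine_cvg cv).
Unshelve. all: by end_near. Qed.

Variables (gamma sigma : R) (Pi : {measure set R -> \bar R}).
Hypothesis Pi_levy : levy_measure Pi.

Let h theta x := 1 - expR (- (theta * x)) - theta * x * \1_`]0, 1[ x.

(* Both sides of [psi t = t * phi t], divided by [t ^+ 2], converge to the
   coefficient of the quadratic part as [t] tends to infinity. *)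
Lemma descending_ladder_height_drift kappa delta (Lambda : {measure set R -> \bar R}) :
  descending_ladder_height (laplace_exponent gamma sigma Pi) 0 kappa delta Lambda ->
  delta = 2^-1 * sigma ^+ 2.
Proof.
move=> [[_ _ _ Lfin] psiE].
pose t n : R := n.+1%:R.
have t1 n : 1 <= t n by rewrite ler1n.
have t0 n : 0 < t n by rewrite ltr0n.
have tV n : (t n)^-1 <= 1 by rewrite invf_le1.
have cvV : (fun n => (t n)^-1) @ \oo --> (0 : R) by exact: cvg_harmonic.
pose e theta x := 1 - expR (- (theta * x)).
have e0 theta x : 0 <= theta -> 0 < x -> 0 <= e theta x.
  by move=> th0 x0; rewrite subr_ge0 expR_le1 oppr_le0 mulr_ge0// ltW.
have e1 theta x : e theta x <= 1 by rewrite gerBl expR_ge0.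
have ex theta x : e theta x <= theta * x.
  by have := expR_ge1Dx (- (theta * x)); rewrite /e; lra.
have me theta : measurable_fun D (e theta).
  by apply: measurable_funB; [exact: measurable_cst|exact: measurable_expRN].
have ILm : Lambda.-integrable D (EFin \o (fun x => Num.min 1 x)).
  apply: ge0_integrable => //; last by move=> x /D0 x0; rewrite le_min ler01 ltW.
  by apply: measurable_minr; [exact: measurable_cst|exact: measurable_id].
have eV n x : 0 < x -> `|(t n)^-1 * e (t n) x| <= Num.min 1 x.
  move=> x0; rewrite ger0_norm ?mulr_ge0 ?invr_ge0 ?e0// ?(ltW (t0 n))//.
  rewrite le_min ler_pdivrMl// ler_pdivrMl// mulr1 ex (le_trans (e1 _ _))//.
have Ie n : Lambda.-integrable D (EFin \o (fun x => (t n)^-1 * e (t n) x)).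
  apply: (le_integrable mD _ _ ILm).
    by apply/measurable_EFinP; apply: measurable_funM => //; exact: measurable_cst.
  move=> x /D0 x0; rewrite /= lee_fin (le_trans (eV n x x0))//.
  exact: ler_norm.
have Ie' n : Lambda.-integrable D (EFin \o (fun x => e (t n) x)).
  have := integrableZl mD (t n) (Ie n).
  apply: eq_integrable => // x _.
  by rewrite /= -EFinM mulrA divff ?mul1r// gt_eqF.
have mh n : measurable_fun D (h (t n)).
  by apply/measurable_EFinP; exact: (measurable_int Pi
    (levy_integrand_integrable Pi_levy (ltW (t0 n)))).
(* The domination uses [theta ^ 2 + 1 <= 2 theta ^ 2] for [theta >= 1], and the pointwise decay uses
   [|h theta x| <= 1 + theta x]. *)
have cvh : (fun n => \int[Pi]_(x in D) ((t n)^-1 ^+ 2 * h (t n) x)) @ \oo --> (0 : R).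
  apply: (@dominated_Rintegral_cvg0 _ _ (fun x => 2 * Num.min 1 (x ^+ 2)) (fun x => 1 + x)).
  - by move=> n; apply: measurable_funM => //; exact: measurable_cst.
  - exact: (integrableZl mD 2 (levy_min_integrable Pi_levy)).
  - move=> n x /D0 x0; rewrite normrM normrX gtr0_norm ?invr_gt0//.
    rewrite exprVn ler_pdivrMl ?exprn_gt0//.
    apply: (le_trans (levy_integrand_le (ltW (t0 n)) x0)).
    rewrite mulrA ler_wpM2r ?le_min ?ler01 ?sqr_ge0//.
    by have : 1 <= t n ^+ 2 by [rewrite exprn_ege1]; lra.
  - move=> n x /D0 x0; rewrite normrM normrX gtr0_norm ?invr_gt0//.
    have hx : `|h (t n) x| <= 1 + t n * x.
      rewrite /h (le_trans (ler_normB _ _))// lerD//.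
        by rewrite ger0_norm ?e1// e0// ltW.
      rewrite ger0_norm ?mulr_ge0 ?indic_ge0 ?(ltW x0) ?(ltW (t0 n))//.
      by rewrite ler_piMr ?mulr_ge0 ?(ltW x0) ?(ltW (t0 n))// indicE lern1 leq_b1.
    have tV0 : 0 <= (t n)^-1 by rewrite invr_ge0 ltW.
    apply: (le_trans (ler_wpM2l (exprn_ge0 2 tV0) hx)).
    have -> : (t n)^-1 ^+ 2 * (1 + t n * x) = ((t n)^-1 + x) * (t n)^-1.
      by field; rewrite gt_eqF.
    by rewrite ler_wpM2r// lerD2r.
have cve : (fun n => \int[Lambda]_(x in D) ((t n)^-1 * e (t n) x)) @ \oo --> (0 : R).
  apply: (@dominated_Rintegral_cvg0 _ _ (fun x => Num.min 1 x) (fun=> 1)) => //.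
  - by move=> n; apply: measurable_funM => //; exact: measurable_cst.
  - by move=> n x /D0; exact: eV.
  - move=> n x /D0 x0; rewrite mul1r ger0_norm.
      by rewrite ler_piMr ?invr_ge0 ?(ltW (t0 n)).
    by rewrite mulr_ge0 ?invr_ge0 ?e0// ?(ltW (t0 n)).
have E n : gamma * (t n)^-1 + 2^-1 * sigma ^+ 2
      - \int[Pi]_(x in D) ((t n)^-1 ^+ 2 * h (t n) x) =
    kappa * (t n)^-1 + delta + \int[Lambda]_(x in D) ((t n)^-1 * e (t n) x).
  have tN : t n != 0 by rewrite gt_eqF.
  rewrite !RintegralZl//; last exact: (levy_integrand_integrable Pi_levy (ltW (t0 n))).
  have := psiE (t n) (ltW (t0 n)); rewrite subr0 /laplace_exponent /subordinator_exponent.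
  rewrite -/(h (t n)) -/(e (t n)).
  set I := \int[Pi]_(x in _) _; set J := \int[Lambda]_(x in _) _ => H.
  transitivity ((gamma * t n + 2^-1 * sigma ^+ 2 * t n ^+ 2 - I) * (t n)^-1 ^+ 2).
    by rewrite /I; field.
  by rewrite H /J; field.
have cvl : (fun n => gamma * (t n)^-1 + 2^-1 * sigma ^+ 2
      - \int[Pi]_(x in D) ((t n)^-1 ^+ 2 * h (t n) x)) @ \oo -->
    gamma * 0 + 2^-1 * sigma ^+ 2 - 0.
  apply: cvgB => //; apply: cvgD; last exact: cvg_cst.
  exact: cvgMl_tmp.
have cvr : (fun n => gamma * (t n)^-1 + 2^-1 * sigma ^+ 2
      - \int[Pi]_(x in D) ((t n)^-1 ^+ 2 * h (t n) x)) @ \oo -->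
    kappa * 0 + delta + 0.
  under eq_fun do rewrite E.
  apply: cvgD => //; apply: cvgD; last exact: cvg_cst.
  exact: cvgMl_tmp.
have := cvg_unique _ cvr cvl.
by rewrite !mulr0 !add0r addr0 subr0; exact.
Qed.

End drift.

(** Restricting to [y > 0] treats [x = 0] uniformly: [W] may jump there, and is continuous from the
    right only. *)
Lemma within_nonneg_continuous (R : realType) (W : R -> R) :
  {within `[0, +oo[, continuous W} ->
  forall x, 0 <= x -> forall e, 0 < e -> exists2 d, 0 < d &
    forall y, 0 < y -> `|y - x| < d -> `|W y - W x| <= e.
Proof.
move=> /continuous_within_itvcyP[cW W0] x; rewrite le_eqVlt => /orP[/eqP <-|x0] e e0.
  have /cvgrPdist_le /(_ e e0) := W0.
  rewrite /at_right /within /= => /nbhs_ballP[d /= d0 H]; exists d => // y y0 yd.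
  rewrite distrC; apply: (H y) => //.
  by rewrite /ball /= distrC.
have xI : x \in `]0, +oo[ by rewrite in_itv/= x0.
have /cvgrPdist_le /(_ e e0) := cW x xI.
move=> /nbhs_ballP[d /= d0 H]; exists d => // y y0 yd.
by rewrite distrC; apply: (H y); rewrite /ball /= distrC.
Qed.

Theorem theorem2p2 (R : realType) (d : measure_display)
    (Omega : measurableType d) (P : probability Omega R)
    (X : R -> {RV P >-> R})
    (gamma sigma : R) (Pi : {measure set R -> \bar R}) (dens : R -> R)
    (Phi0 : R) (W : R -> R)
    (hX : spectrally_negative_levy_process X)
    (htriplet : levy_triplet X gamma sigma Pi)
    (hdens : positive_density Pi dens)
    (hroot : largest_root (laplace_exponent gamma sigma Pi) Phi0)
    (hPhi0 : Phi0 = 0)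
    (hW : scale_function (laplace_exponent gamma sigma Pi) Phi0 W)
    (hconvex : log_convex_on `]0, +oo[ (tail dens)) :
  [/\ differentiable_on_pos W /\ convex_on `]0, +oo[ (W^`())%classic,
      forall (kappa delta : R) (Lambda : {measure set R -> \bar R}),
        descending_ladder_height (laplace_exponent gamma sigma Pi) Phi0
          kappa delta Lambda ->
        (0 < sigma <-> 0 < delta) &
      0 < sigma -> C2_on_pos W].
Proof.
subst Phi0; have [sigma0 Pi_levy _] := htriplet.
set psi := laplace_exponent gamma sigma Pi in hroot hW *.
have [W_ge0 _ W_cont W_homo W_lap] := hW.
have [_ _ psi_root] := hroot.
(* Beyond the largest root [psi] does not vanish, and [1 / psi t] is the integral of a nonnegative
   function. *)
have psi_gt0 t : 0 < t -> 0 < psi t.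
  move=> t0; rewrite lt_neqAle; apply/andP; split.
    by apply/eqP => /esym/(psi_root t (ltW t0)); rewrite leNgt t0.
  rewrite -invr_ge0 -div1r -lee_fin -(W_lap t t0).
  by apply: integral_ge0 => x _; rewrite lee_fin mulr_ge0 ?expR_ge0.
have [dens_gt0 dens_convex] := hconvex.
have g_gt0 s : 0 < s -> 0 < tail dens s.
  by move=> s0; apply: dens_gt0; rewrite /= in_itv/= andbT.
have g_noninc s t : 0 < s -> s <= t -> tail dens t <= tail dens s.
  exact: (tail_noninc Pi_levy hdens).
have mg : measurable_fun (`]0, +oo[%classic : set R) (tail dens).
  (* Monotone functions on the whole line are measurable. The tail is monotone on the positive reals
     only, but [expR (- tail)] is positive and nondecreasing there, so its extension by 0 is
     monotone. *)
  pose f x := if x <= 0 then 0 else expR (- tail dens x).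
  have mf : measurable_fun (`]0, +oo[%classic : set R) f.
    apply: (@nondecreasing_measurable R _ f); first exact: measurable_itv.
    move=> x y xy; rewrite /f.
    case: (leP x 0) => x0; first by case: ifP => // _; exact: expR_ge0.
    have -> : (y <= 0) = false by rewrite leNgt (lt_le_trans x0 xy).
    by rewrite ler_expR lerN2 g_noninc.
  apply: (eq_measurable_fun (fun x => - ln (f x))).
    move=> x; rewrite inE/= in_itv/= andbT => x0.
    have -> : f x = expR (- tail dens x) by rewrite /f leNgt x0.
    by rewrite expRK opprK.
  by apply: measurableT_comp => //; apply: (measurableT_comp (@measurable_ln R)).
have mWc : measurable_fun (`[0, +oo[%classic : set R) W.
  by apply: subspace_continuous_measurable_fun => //; exact: measurable_itv.
have mW : measurable_fun (`]0, +oo[%classic : set R) W.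
  apply: measurable_funS mWc; first exact: measurable_itv.
  by move=> x /=; rewrite !in_itv/= !andbT => /ltW.
have W_laplace t : 0 < t ->
    (\int[lebesgue_measure]_(s in `]0%R, +oo[) (expR (- (t * s)) * W s)%:E = ((psi t)^-1)%:E)%E.
  move=> t0; rewrite -div1r -W_lap// integral_itv_obnd_cbnd//.
  by apply/measurable_EFinP; apply: measurable_funM => //; exact: measurable_expRN.
have W_nondec s t : 0 <= s -> s <= t -> W s <= W t.
  move=> s0 st; apply: W_homo => //; rewrite in_itv/= andbT//.
  exact: le_trans st.
have delta_ge0 : 0 <= 2^-1 * sigma ^+ 2 by rewrite mulr_ge0// ?invr_ge0// sqr_ge0.
have [] := scale_regularity delta_ge0 mg g_gt0 g_noninc
  (convex_on_three_point dens_convex) psi_gt0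
  (laplace_exponent_incr gamma sigma Pi_levy hdens) mW (fun s _ => W_ge0 s) W_nondec
  (within_nonneg_continuous W_cont) W_laplace.
move=> dW cW C2W.
have sigmaE : (0 < sigma) = (0 < 2^-1 * sigma ^+ 2).
  rewrite pmulr_rgt0 ?invr_gt0// exprn_even_gt0//= lt_neqAle sigma0 andbT.
  by rewrite eq_sym.
split.
- by split.
- by move=> kappa delta Lambda /(descending_ladder_height_drift Pi_levy) ->; rewrite sigmaE.
- by move=> s0; apply: C2W; rewrite -sigmaE.
Qed.
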